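(* Let $\mathcal{R}\subset\mathcal{O}=\mathbb{F}_q[[z]]$ be an arbitrary unibranch singularity ring (not necessarily with $2$ generators or Gorenstein), $c\ge1$, $\Omega=\mathcal{O}^{\oplus c}$. For a standard $M\subset\Omega$ let $M^\Diamond=\{f\in\Omega\mid\mathfrak{m}_{\mathcal R}f\subset M\}$, which is an $\mathcal{R}$-module, and $d^\Diamond(M)=\dim_{\mathbb{F}_q}(M^\Diamond/M)$. Then $M^\Diamond=\Omega$ if $M\supset\mathfrak{m}_{\mathcal R}\Omega$, and $M^\Diamond=M$ if and only if $M=\Omega$. Moreover: (i) For every standard $M$, the contribution to $\mathcal{H}^{mot}(c)$ of the standard flags with $M_0=M$ is $$t^{\deg(M)}\Bigl(1+\frac at\Bigr)\Bigl(1+\frac atq\Bigr)\cdots\Bigl(1+\frac atq^{d-1}\Bigr),\qquad d=d^\Diamond(M),$$ so it depends only on $\deg(M)$ and $d^\Diamond(M)$. Consequently $$\mathcal{H}^{mot}(c)=\sum_Mt^{\deg(M)}\Bigl(1+\frac at\Bigr)\Bigl(1+\frac atq\Bigr)\cdots\Bigl(1+\frac atq^{d^\Diamond(M)-1}\Bigr),$$ summed over all standard $M\subset\Omega$. (ii) Let $N\subset\Omega$ be a standard module and $r=rk_q(N)-c$. The total contribution to $\mathcal{H}^{mot}(c)$ of all standard flags $M_0\subset\cdots\subset M_\ell$ with $\mathfrak{m}_{\mathcal R}N\subset M_0$ and $M_\ell\subset N$ is $$\sum_{d=0}^{r}t^{\deg(N)+d}\,q^{cd}\begin{bmatrix}r\\d\end{bmatrix}_q\Bigl(1+\frac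 at\Bigr)\Bigl(1+\frac atq\Bigr)\cdots\Bigl(1+\frac atq^{d-1}\Bigr),$$ where the $d$-th term is the contribution of the flags with $\dim_{\mathbb{F}_q}N/M_0=d$ (so $\deg(M_0)=\deg(N)+d$). (iii) For $\mathcal{R}=\mathbb{F}_q[[z^2,z^3]]$ one has $M^\Diamond=\Omega$ for every standard $M$, one can take $N=\Omega$, $r=c$ in (ii), and $$\mathcal{H}^{mot}(c)=\sum_{d=0}^{c}q^{cd}t^d\begin{bmatrix}c\\d\end{bmatrix}_q\Bigl(1+\frac at\Bigr)\cdots\Bigl(1+\frac atq^{d-1}\Bigr).$$
   Context: A unibranch singularity ring is an $\mathbb{F}_q$-subalgebra $\mathcal{R}\subset\mathcal{O}=\mathbb{F}_q[[z]]$ with $1\in\mathcal{R}$ that is complete local with field of fractions $\mathbb{F}_q((z))$; equivalently $z^N\mathcal{O}\subset\mathcal{R}$ for some $N$. Put $\mathfrak{m}_{\mathcal R}=\mathcal{R}\cap z\mathcal{O}$ and let $\nu_z$ be the $z$-adic valuation. (In this theorem it is assumed that $\mathcal{R}\ne\mathcal{O}$ is allowed but not required.) Let $\Omega=\oplus_{i=1}^c\mathcal{O}\varepsilon_i$ and fix real numbers $0=\nu^1<\cdots<\nu^c<1$. Define $\nu(\sum_if_i\varepsilon_i)=\min_i(\nu_z(f_i)+\nu^i)$. For an $\mathcal{R}$-submodule $M\subset\Omega$ (diagonal action) put $\Delta^c(M)=\{\nu(v)\mid0\ne v\in M\}$, $\deg(M)=\dim_{\mathbb{F}_q}(\Omega/M)$,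 $rk_q(M)=\dim_{\mathbb{F}_q}(M/\mathfrak{m}_{\mathcal R}M)$. $M$ is standard if $\mathcal{O}M=\Omega$. A standard $\ell$-flag ($\ell\ge0$) is a chain $M_0\subset\cdots\subset M_\ell\subset\Omega$ of $\mathcal{R}$-submodules with $M_0$ standard, $\dim_{\mathbb{F}_q}M_i/M_{i-1}=1$, $\Delta^c(M_i)=\Delta^c(M_{i-1})\cup\{g_i\}$ (disjoint union) for $1\le i\le\ell$, and $g_1<\cdots<g_\ell$. The motivic superpolynomial is $\mathcal{H}^{mot}(c)=\sum t^{\deg(M_\ell)}a^\ell$ over all standard flags (a finite sum); the contribution of a set of flags is the corresponding partial sum. $\begin{bmatrix}r\\d\end{bmatrix}_q$ is the Gaussian binomial coefficient; empty products are $1$. *)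

(* Defs.v *)
From HB Require Import structures.
From mathcomp Require Import all_boot all_order all_algebra fraction.
From mathcomp Require Import all_classical all_reals.

Set Implicit Arguments.
Unset Strict Implicit.
Unset Printing Implicit Defensive.

Import Order.TTheory GRing.Theory Num.Theory.
Local Open Scope classical_set_scope.
Local Open Scope ring_scope.

(** * Formal power series F[[z]] as a commutative F-algebra *)

Record fps (F : Type) := Fps { fps_coef :> nat -> F }.

HB.instance Definition _ (F : Type) := gen_eqMixin (fps F).
HB.instance Definition _ (F : Type) := gen_choiceMixin (fps F).

Section FpsRing.
Context {F : comNzRingType}.
Implicit Types f g h : fps F.

Definition fps_zero : fps F := Fps (fun=> 0).
Definition fps_one : fps F := Fps (fun n => (n == 0%N)%:R).
Definition fps_opp f : fps F := Fps (fun n => - f n).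
Definition fps_add f g : fps F := Fps (fun n => f n + g n).
Definition fps_mul f g : fps F :=
  Fps (fun n => \sum_(i < n.+1) f i * g (n - i)%N).
Definition fps_scale (a : F) f : fps F := Fps (fun n => a * f n).

Lemma fpsP f g : (forall n, f n = g n) -> f = g.
Proof. by case: f g => [f] [g] /= /funext ->. Qed.

Lemma fps_addA : associative fps_add.
Proof. by move=> f g h; apply: fpsP => n; rewrite /= addrA. Qed.

Lemma fps_addC : commutative fps_add.
Proof. by move=> f g; apply: fpsP => n; rewrite /= addrC. Qed.

Lemma fps_add0 : left_id fps_zero fps_add.
Proof. by move=> f; apply: fpsP => n; rewrite /= add0r. Qed.

Lemma fps_addN : left_inverse fps_zero fps_opp fps_add.
Proof. by move=> f; apply: fpsP => n; rewrite /= addNr. Qed.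

HB.instance Definition _ :=
  GRing.isZmodule.Build (fps F) fps_addA fps_addC fps_add0 fps_addN.

Definition fps_trunc n f : {poly F} := \poly_(i < n.+1) f i.

Lemma fps_mul_coef n f g (p q : {poly F}) :
  (forall k, (k <= n)%N -> f k = p`_k) ->
  (forall k, (k <= n)%N -> g k = q`_k) ->
  forall k, (k <= n)%N -> fps_mul f g k = (p * q)`_k.
Proof.
move=> fp gq k kn; rewrite coefM /=; apply: eq_bigr => i _.
rewrite fp ?gq //; first exact: leq_trans (leq_subr _ _) kn.
by apply: leq_trans kn; rewrite -ltnS.
Qed.

Lemma fps_truncE n f k : (k <= n)%N -> f k = (fps_trunc n f)`_k.
Proof. by move=> kn; rewrite coef_poly ltnS kn. Qed.

Lemma fps_mulA : associative fps_mul.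
Proof.
move=> f g h; apply: fpsP => n.
have T := @fps_truncE n.
rewrite (fps_mul_coef (T f) (fps_mul_coef (T g) (T h)) (leqnn n)).
by rewrite (fps_mul_coef (fps_mul_coef (T f) (T g)) (T h) (leqnn n)) mulrA.
Qed.

Lemma fps_mulC : commutative fps_mul.
Proof.
move=> f g; apply: fpsP => n; have T := @fps_truncE n.
by rewrite !(fps_mul_coef (T _) (T _) (leqnn n)) mulrC.
Qed.

Lemma fps_mul1 : left_id fps_one fps_mul.
Proof.
move=> f; apply: fpsP => n /=; rewrite big_ord_recl /= mul1r subn0.
by rewrite big1 ?addr0 // => i _; rewrite mul0r.
Qed.

Lemma fps_mulDl : left_distributive fps_mul fps_add.
Proof.
move=> f g h; apply: fpsP => n /=; rewrite -big_split /=.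
by apply: eq_bigr => i _; rewrite mulrDl.
Qed.

Lemma fps_one_neq0 : fps_one != 0.
Proof.
by apply/eqP => /(congr1 (fun f : fps F => f 0%N)) /= /eqP; rewrite oner_eq0.
Qed.

HB.instance Definition _ := GRing.Zmodule_isComNzRing.Build (fps F)
  fps_mulA fps_mulC fps_mul1 fps_mulDl fps_one_neq0.

Lemma fps_scaleA a b f : fps_scale a (fps_scale b f) = fps_scale (a * b) f.
Proof. by apply: fpsP => n; rewrite /= mulrA. Qed.

Lemma fps_scale1 : left_id 1 fps_scale.
Proof. by move=> f; apply: fpsP => n; rewrite /= mul1r. Qed.

Lemma fps_scaleDr : right_distributive fps_scale +%R.
Proof. by move=> a f g; apply: fpsP => n; rewrite /= mulrDr. Qed.

Lemma fps_scaleDl f : {morph fps_scale^~ f : a b / a + b}.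
Proof. by move=> a b; apply: fpsP => n; rewrite /= mulrDl. Qed.

HB.instance Definition _ := GRing.Zmodule_isLmodule.Build F (fps F)
  fps_scaleA fps_scale1 fps_scaleDr fps_scaleDl.

Lemma fps_scaleAl (a : F) f g : a *: (f * g) = (a *: f) * g.
Proof.
apply: fpsP => n /=; rewrite mulr_sumr.
by apply: eq_bigr => i _; rewrite mulrA.
Qed.

HB.instance Definition _ := GRing.Lmodule_isLalgebra.Build F (fps F) fps_scaleAl.
HB.instance Definition _ := GRing.Lalgebra_isComAlgebra.Build F (fps F).

Definition fpsz : fps F := Fps (fun n => (n == 1%N)%:R).

End FpsRing.

(** * Unibranch singularity rings and modules *)

(* For an F-subalgebra A of F[[z]], containing a conductor ideal z^N F[[z]] is
   equivalent to being complete local with field of fractions F((z)). *)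
Definition unibranch (F : comNzRingType) (A : set (fps F)) : Prop :=
  GRing.subalg_closed [in A] /\ exists N, forall f, A (fpsz ^+ N * f).

Definition maxideal (F : comNzRingType) (A : set (fps F)) : set (fps F) :=
  [set f | A f /\ exists g, f = fpsz * g].

(* The subring F[[z^2,z^3]]: images of the two-variable power series
   \sum_(i,j) a i j x^i y^j under x |-> z^2, y |-> z^3. *)
Definition cusp_ring (F : comNzRingType) : set (fps F) :=
  [set f | exists a : nat -> nat -> F, forall n,
    f n = \sum_(i < n.+1) \sum_(j < n.+1 | (2 * i + 3 * j == n)%N) a i j].

Notation Omega F c := 'rV[fps F]_c.

Definition submodule (F : comNzRingType) c (A : set (fps F))
    (M : set (Omega F c)) : Prop :=
  [/\ M 0, forall u v, M u -> M v -> M (u + v)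
    & forall r v, A r -> M v -> M (r *: v)].

(* The set of finite sums of products r *: v, with r in I and v in M. *)
Definition smul (F : comNzRingType) c (I : set (fps F))
    (M : set (Omega F c)) : set (Omega F c) :=
  [set v | exists n (r : 'I_n -> fps F) (u : 'I_n -> Omega F c),
     [/\ forall k, I (r k), forall k, M (u k) & v = \sum_k r k *: u k]].

Definition standard (F : comNzRingType) c (A : set (fps F))
    (M : set (Omega F c)) : Prop :=
  submodule A M /\ smul setT M = setT.

(* dim_F (V / W) = d for F-subspaces W of V; the scalar a : F acts on Omega
   through the constant series a%:A. *)
Definition has_qdim (F : comNzRingType) c (V W : set (Omega F c)) (d : nat) :
    Prop :=
  exists e : 'I_d -> Omega F c, (forall i, V (e i)) /\
    forall v, V v ->
      exists! a : {ffun 'I_d -> F}, W (v - \sum_i (a i)%:A *: e i).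

(* Junk value 0 when V / W is infinite-dimensional. *)
Definition qdim (F : comNzRingType) c (V W : set (Omega F c)) : nat :=
  xget 0%N [set d | has_qdim V W d].

Definition deg (F : comNzRingType) c (M : set (Omega F c)) : nat :=
  qdim setT M.

Definition rkq (F : comNzRingType) c (A : set (fps F)) (M : set (Omega F c)) :
    nat :=
  qdim M (smul (maxideal A) M).

Definition diamond (F : comNzRingType) c (A : set (fps F))
    (M : set (Omega F c)) : set (Omega F c) :=
  [set f | forall r, maxideal A r -> M (r *: f)].

Definition ddiamond (F : comNzRingType) c (A : set (fps F))
    (M : set (Omega F c)) : nat :=
  qdim (diamond A M) M.

(** * Valuations and standard flags *)

Definition valz (R : realType) (F : comNzRingType) (f : fps F) : \bar R :=
  match pselect (exists n, f n != 0) with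
  | left f_neq0 => (ex_minn f_neq0)%:R%:E
  | right _ => +oo%E
  end.

Definition val_Omega (R : realType) (F : comNzRingType) c (nu : 'I_c -> R)
    (v : Omega F c) : \bar R :=
  \big[mine/+oo%E]_(i < c) (valz R (v ord0 i) + (nu i)%:E)%E.

Definition Delta (R : realType) (F : comNzRingType) c (nu : 'I_c -> R)
    (M : set (Omega F c)) : set R :=
  [set x | exists v, [/\ M v, v != 0 & val_Omega nu v = x%:E]].

(* A flag M_0, M_1, ..., M_l is encoded as (M_0, [:: M_1; ...; M_l]). *)
Definition flag (F : comNzRingType) c : Type :=
  (set (Omega F c) * seq (set (Omega F c)))%type.

HB.instance Definition _ (F : comNzRingType) c := Choice.on (flag F c).

Definition fbot (F : comNzRingType) c (p : flag F c) := p.1.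
Definition ftop (F : comNzRingType) c (p : flag F c) := last p.1 p.2.
Definition flen (F : comNzRingType) c (p : flag F c) := size p.2.
Definition fnth (F : comNzRingType) c (p : flag F c) (i : nat) :=
  nth set0 (p.1 :: p.2) i.

(* g`_i is the element written g_{i+1} in the usual indexing. *)
Definition std_flag (R : realType) (F : comNzRingType) c (nu : 'I_c -> R)
    (A : set (fps F)) : set (flag F c) :=
  [set p | standard A (fbot p) /\
    exists g : seq R, [/\ size g = flen p, sorted <%R g &
      forall i, (i < flen p)%N ->
        [/\ submodule A (fnth p i.+1),
            fnth p i `<=` fnth p i.+1,
            has_qdim (fnth p i.+1) (fnth p i) 1%N,
            ~ Delta nu (fnth p i) g`_i
          & Delta nu (fnth p i.+1) = Delta nu (fnth p i) `|` [set g`_i]]]].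

(** * The motivic superpolynomial *)

(* Z[a][t], and its fraction field, in which a / t makes sense. *)
Notation Zat := {poly {poly int}}.
Notation Qat := {fraction Zat}.

Definition t_poly : Zat := 'X.
Definition a_poly : Zat := 'X%:P.
Definition t_frac : Qat := tofrac t_poly.
Definition a_frac : Qat := tofrac a_poly.

(* Finite-support sum; it is meaningful on finite sets of flags only. *)
Definition contribution (F : comNzRingType) c (S : set (flag F c)) : Zat :=
  \sum_(p \in S) (t_poly ^+ deg (ftop p) * a_poly ^+ flen p).

Definition Hmot (R : realType) (F : comNzRingType) c (nu : 'I_c -> R)
    (A : set (fps F)) : Zat :=
  contribution (std_flag nu A).

Definition qfactor (q d : nat) : Qat :=
  \prod_(i < d) (1 + a_frac / t_frac * q%:R ^+ i).

Definition gauss_binom (q r d : nat) : Qat :=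
  \prod_(i < d) ((q%:R ^+ (r - i) - 1) / (q%:R ^+ i.+1 - 1)).

(* Main.v *)
From HB Require Import structures.
Require Import Defs.
From mathcomp Require Import all_boot all_order all_algebra fraction.
From mathcomp Require Import all_classical all_reals.
Set Implicit Arguments.
Unset Strict Implicit.
Unset Printing Implicit Defensive.
Import Order.TTheory GRing.Theory Num.Theory.
Local Open Scope classical_set_scope.
Local Open Scope ring_scope.

(** Everything takes place between [Omega] and one fixed subspace
z^n [Omega], which every standard module contains because the ring contains a
conductor ideal; so only finite-dimensional linear algebra over F_q is left.
Since the [nu i] are increasing in [0, 1), the monomials z^n eps_i are totally
ordered by their valuation n + nu_i, in the order of the natural number
n * c + i.  Replacing a valuation by this position, [Delta nu M] becomes the
set [leads] of leading positions of elements of M.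

(i) Let M_0 < ... < M_l be a standard flag and u an element of M_i of leading
position g_i.  For r in the maximal ideal, r u leads strictly after g_i, so it
lies in M_(i-1) and all its possible leads are already leads of M_0; hence it
lies in M_0.  So the top of the flag lies in the diamond of M_0
([chain_diamond]).  Conversely each F_q-subspace between M_0 and its diamond is
a module ([submodule_between]).  It remains to count chains of subspaces
between M_0 and a subspace P, inside the diamond, with increasing new
positions.  If dim P/M_0 = d, let p_1 < ... < p_d be the leading positions of
P that are not leading positions of M_0.  A chain either uses p_1, and then it
starts with one of the q^(d-1) subspaces M_0 + F u where u leads at p_1 (u is
unique modulo M_0 up to a scalar and up to the d-1 later positions), or it
does not.  Both kinds continue in the same way with p_2, ..., p_d, which gives
the factor 1 + (a/t) q^(d-1), and by induction the whole product
([enum_chain], [flag_sum]).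

(ii) The bottoms of the flags are the modules M between mN and N that are
standard.  By Nakayama, M is standard iff M maps onto [Omega] / z [Omega], that
is, iff M + K = N, where K is the kernel of N -> [Omega] / z [Omega].  Here
K / mN has dimension r = rk N - c and N / K has dimension c.  The subspaces of
codimension d transverse to K are counted by recursion on r: choose f in K
outside mN; either M contains f, or M is one of the q^(c+r-d) complements of f
in M + F f.  This is the Pascal rule for q^(cd) times the Gaussian binomial
([enum_transverse], [transverse_countE]).  Over each M the flags are counted by
(i) with P = N.

(iii) The cusp ring consists of the series without a term of degree 1; its
conductor is z^2 F_q[[z]], which is also its maximal ideal, so every standard
module contains z^2 [Omega] and the case N = [Omega] of (ii) applies. *)

(** * Subspaces of finite codimension *)

Section Subspaces.
Context {F : finFieldType} {T : lmodType F}.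
Implicit Types (X Y Z M N K : set T) (u v w : T).

Definition subspace X := X 0 /\ forall (a : F) u v, X u -> X v -> X (a *: u + v).

(** This is [has_qdim] over an arbitrary F-vector space: the coordinates on the
basis e of Y / X are unique.  As F is finite, they make dim Y / X = d a
statement about a bijection with a finite set. *)
Definition codim Y X d := exists e : 'I_d -> T, (forall i, Y (e i)) /\
  forall v, Y v -> exists! a : {ffun 'I_d -> F}, X (v - \sum_i a i *: e i).

(** The subspace X + F u. *)
Definition adjoin X u : set T := [set v | exists a : F, X (v - a *: u)].

Lemma subspace0 X : subspace X -> X 0. Proof. by case. Qed.

Lemma subspaceD X u v : subspace X -> X u -> X v -> X (u + v).
Proof. by move=> [_ h] Xu Xv; rewrite -[u]scale1r; apply: h. Qed.

Lemma subspaceZ X a u : subspace X -> X u -> X (a *: u).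
Proof. by move=> [X0 h] Xu; rewrite -[_ *: u]addr0; apply: h. Qed.

Lemma subspaceN X u : subspace X -> X u -> X (- u).
Proof. by move=> sX Xu; rewrite -scaleN1r; apply: subspaceZ. Qed.

Lemma subspaceB X u v : subspace X -> X u -> X v -> X (u - v).
Proof. by move=> sX Xu Xv; apply: subspaceD => //; apply: subspaceN. Qed.

Lemma subspace_sum X (I : Type) (r : seq I) (f : I -> T) :
  subspace X -> (forall i, X (f i)) -> X (\sum_(i <- r) f i).
Proof.
move=> sX Xf; elim/big_ind: _ => //; first exact: subspace0.
by move=> u v; apply: subspaceD.
Qed.

Lemma subspace_trans X u v w : subspace X -> X (u - v) -> X (v - w) -> X (u - w).
Proof. by move=> sX h1 h2; rewrite -(subrKA v); apply: subspaceD. Qed.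

Lemma subspaceZK X a u : subspace X -> a != 0 -> X (a *: u) -> X u.
Proof. by move=> sX a0 Xu; rewrite -(scalerK a0 u); apply: subspaceZ. Qed.

Lemma subspaceDK X u v : subspace X -> X (u - v) -> X v -> X u.
Proof. by move=> sX h Xv; rewrite -(subrK v u); apply: subspaceD. Qed.

Lemma subspaceI X Y : subspace X -> subspace Y -> subspace (X `&` Y).
Proof.
move=> sX sY; split; first by split; apply: subspace0.
by move=> a u v [Xu Yu] [Xv Yv]; split; [apply: sX.2|apply: sY.2].
Qed.

Lemma codim_free X Y d (e : 'I_d -> T) (a : {ffun 'I_d -> F}) :
  subspace X -> subspace Y -> (forall i, Y (e i)) ->
  (forall v, Y v -> exists! a : {ffun 'I_d -> F}, X (v - \sum_i a i *: e i)) ->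
  X (\sum_i a i *: e i) -> a = [ffun=> 0].
Proof.
move=> sX sY Ye he Xa; have [b [Xb ub]] := he 0 (subspace0 sY).
transitivity b; first by apply/esym/ub; rewrite sub0r; apply: subspaceN.
apply: ub; rewrite big1 ?subr0; first exact: subspace0.
by move=> i _; rewrite ffunE scale0r.
Qed.

(** Coordinates in the second basis, taken on the span of the first, are an
injection of F^d into F^d', so counting elements compares the dimensions. *)
Lemma codim_leq X Y d d' : subspace X -> subspace Y ->
  codim Y X d -> codim Y X d' -> (d <= d')%N.
Proof.
move=> sX sY [e [Ye he]] [e' [Ye' he']].
have Ysum (a : {ffun 'I_d -> F}) : Y (\sum_i a i *: e i).
  by apply: subspace_sum => // i; apply: subspaceZ.
pose f (a : {ffun 'I_d -> F}) := projT1 (cid (he' _ (Ysum a))).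
have fP (a : {ffun 'I_d -> F}) : X (\sum_i a i *: e i - \sum_i f a i *: e' i).
  by rewrite /f; case: cid => b [].
have f_inj : injective f.
  move=> a b fab; have [a0 [_ h]] := he _ (Ysum a).
  rewrite -(h a); last by rewrite subrr; apply: subspace0.
  apply: h; apply: (subspace_trans sX (fP a)); rewrite fab -opprB; apply: subspaceN => //.
have := leq_card f f_inj; rewrite !card_ffun !card_ord leq_exp2l //.
exact: card_finNzRing_gt1.
Qed.

Lemma codim_inj X Y d d' : subspace X -> subspace Y ->
  codim Y X d -> codim Y X d' -> d = d'.
Proof.
by move=> sX sY h h'; apply/eqP; rewrite eqn_leq !(codim_leq sX sY h, codim_leq sX sY h').
Qed.

Lemma codim_refl X : subspace X -> codim X X 0.
Proof.
move=> sX; exists (fun=> 0); split=> [i|v Xv]; first exact: subspace0.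
exists [ffun=> 0]; split; first by rewrite big_ord0 subr0.
by move=> a _; apply/ffunP => -[].
Qed.

Lemma codim0 X Y : subspace X -> codim Y X 0 -> Y `<=` X.
Proof.
by move=> sX [e [_ he]] v /he[a [+ _]]; rewrite big_ord0 subr0.
Qed.

Let glue A d1 d2 (e : 'I_d1 -> A) (f : 'I_d2 -> A) (i : 'I_(d1 + d2)) : A :=
  match fintype.split i with inl j => e j | inr j => f j end.

Let glue_l A d1 d2 (e : 'I_d1 -> A) (f : 'I_d2 -> A) i :
  glue e f (lshift d2 i) = e i.
Proof. by rewrite /glue (unsplitK (inl i)). Qed.

Let glue_r A d1 d2 (e : 'I_d1 -> A) (f : 'I_d2 -> A) i :
  glue e f (rshift d1 i) = f i.
Proof. by rewrite /glue (unsplitK (inr i)). Qed.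

(** The representatives of Y / X and of Z / Y, put together, form a basis of
Z / X. *)
Lemma codim_add X Y Z d1 d2 : subspace X -> subspace Y -> subspace Z ->
  X `<=` Y -> Y `<=` Z ->
  codim Z Y d1 -> codim Y X d2 -> codim Z X (d1 + d2).
Proof.
move=> sX sY sZ XY YZ [e [Ze he]] [f [Yf hf]].
exists (glue e f); split.
  by move=> i; rewrite /glue; case: (fintype.split i) => j //; apply: YZ.
have glueS (a : {ffun 'I_(d1 + d2) -> F}) :
    \sum_i a i *: glue e f i =
    \sum_i [ffun i => a (lshift d2 i)] i *: e i
    + \sum_i [ffun i => a (rshift d1 i)] i *: f i.
  by rewrite big_split_ord /=; congr (_ + _); apply: eq_bigr => i _;
    rewrite ffunE ?glue_l ?glue_r.
move=> v Zv; have [a [Ya ua]] := he v Zv; have [b [Xb ub]] := hf _ Ya.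
exists [ffun i => glue a b i]; split.
  rewrite glueS opprD addrA.
  rewrite (_ : [ffun i => _] = a); last by apply/ffunP => i; rewrite !ffunE glue_l.
  by rewrite (_ : [ffun i => _] = b) //; apply/ffunP => i; rewrite !ffunE glue_r.
move=> g; rewrite glueS opprD addrA => Xg.
set g1 := [ffun i => g (lshift d2 i)] in Xg *.
set g2 := [ffun i => g (rshift d1 i)] in Xg *.
have g1E : a = g1.
  apply: ua; apply: (subspaceDK sY (XY _ Xg)).
  by apply: subspace_sum => // i; apply: subspaceZ.
rewrite -g1E in Xg; have g2E := ub _ Xg.
apply/ffunP => i; rewrite !ffunE.
by case: (split_ordP i) => j ->; rewrite ?glue_l ?glue_r ?g1E ?g2E ffunE.
Qed.

Lemma adjoin_subspace X u : subspace X -> subspace (adjoin X u).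
Proof.
move=> sX; split; first by exists 0; rewrite scale0r subr0; apply: subspace0.
move=> a v w [b Xb] [b' Xb']; exists (a * b + b').
rewrite scalerDl -scalerA opprD. rewrite addrACA -scalerBr.
by apply: subspaceD => //; apply: subspaceZ.
Qed.

Lemma adjoin_sub X u : X `<=` adjoin X u.
Proof. by move=> v Xv; exists 0; rewrite scale0r subr0. Qed.

Lemma adjoin_mem X u : subspace X -> adjoin X u u.
Proof. by move=> sX; exists 1; rewrite scale1r subrr; apply: subspace0. Qed.

Lemma adjoin_min X Y u : subspace Y -> X `<=` Y -> Y u -> adjoin X u `<=` Y.
Proof.
by move=> sY XY Yu v [a Xa]; apply: (subspaceDK sY (XY _ Xa)); apply: subspaceZ.
Qed.

Lemma adjoin_codim X u : subspace X -> ~ X u -> codim (adjoin X u) X 1.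
Proof.
move=> sX Xu; exists (fun=> u); split=> [i|v [a Xa]]; first exact: adjoin_mem.
exists [ffun=> a]; split; first by rewrite big_ord1 ffunE.
move=> b; rewrite big_ord1 => Xb; apply/ffunP => i; rewrite ffunE (ord1 i).
apply/eqP/negP => /negP; rewrite -subr_eq0 => ab; apply: Xu.
apply: (subspaceZK sX ab); rewrite scalerBl.
rewrite (_ : _ - _ = (v - b ord0 *: u) - (v - a *: u)); first exact: subspaceB.
by rewrite opprB [RHS]addrC subrKA.
Qed.

Lemma codim1_adjoin X Y u : subspace X -> subspace Y -> X `<=` Y ->
  codim Y X 1 -> Y u -> ~ X u -> Y = adjoin X u.
Proof.
move=> sX sY XY [e [Ye he]] Yu Xu; apply/seteqP; split; last exact: adjoin_min.
have [a [Xa _]] := he u Yu; rewrite big_ord1 in Xa.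
have a0 : a ord0 != 0.
  by apply/eqP => a0; apply: Xu; move: Xa; rewrite a0 scale0r subr0.
move=> v /he[b [Xb _]]; rewrite big_ord1 in Xb.
exists (b ord0 / a ord0).
have := subspaceZ (b ord0 / a ord0) sX Xa.
rewrite scalerBr scalerA divfK // -opprB => /(subspaceN sX); rewrite opprK => h.
exact: (subspace_trans sX Xb h).
Qed.

End Subspaces.

(** * Leading positions in a filtered space *)

Section Filtration.
Context {F : finFieldType} {T : lmodType F} (digit : T -> nat -> F).
Context (digitP : forall a u v k, digit (a *: u + v) k = a * digit u k + digit v k).
Implicit Types (X Y P : set T) (u v w x y : T).

(** The decreasing filtration of T: vectors whose first k digits vanish. *)
Definition low k : set T := [set v | forall j, (j < k)%N -> digit v j = 0].

Definition lead v k := low k v /\ digit v k != 0.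

(** The analogue of [Delta], with a position in place of a valuation. *)
Definition leads X : set nat := [set k | exists2 v, X v & lead v k].

(** The subspace X + (Y meet low k).  As k decreases these interpolate between X
and Y, and grow by one dimension at each new leading position of Y. *)
Definition tail X Y k : set T := [set v | exists2 y, Y y /\ low k y & X (v - y)].

Lemma digit0 k : digit 0 k = 0.
Proof. by have := digitP (-1) 0 0 k; rewrite scaler0 addr0 mulN1r addNr. Qed.

Lemma digitZ a u k : digit (a *: u) k = a * digit u k.
Proof. by rewrite -[_ *: u]addr0 digitP digit0 addr0. Qed.

Lemma digitD u v k : digit (u + v) k = digit u k + digit v k.
Proof. by rewrite -{1}[u]scale1r digitP mul1r. Qed.

Lemma digitB u v k : digit (u - v) k = digit u k - digit v k.
Proof. by rewrite digitD -scaleN1r digitZ mulN1r. Qed.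

Lemma low_subspace k : subspace (low k).
Proof.
split=> [j _|a u v hu hv j jk]; first exact: digit0.
by rewrite digitP hu // hv // mulr0 addr0.
Qed.

Lemma low_leq j k : (j <= k)%N -> low k `<=` low j.
Proof. by move=> jk v hv i ij; apply: hv; apply: leq_trans jk. Qed.

Lemma lowS k v : low k v -> digit v k = 0 -> low k.+1 v.
Proof. by move=> hv v0 j; rewrite ltnS leq_eqVlt => /predU1P[-> //|]; apply: hv. Qed.

Lemma low_cancel k v w : low k v -> low k w -> digit w k != 0 ->
  low k.+1 (v - (digit v k / digit w k) *: w).
Proof.
move=> hv hw w0; apply: lowS; last by rewrite digitB digitZ divfK // subrr.
by apply: (subspaceB (low_subspace k)) => //; apply: (subspaceZ _ (low_subspace k)).
Qed.

Lemma lead_exists k n v : low k v -> ~ low n v ->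
  exists2 j, (k <= j < n)%N & lead v j.
Proof.
elim: n => [_|n IH hk hn]; first by case.
have [hn'|/(IH hk)[j /andP[kj jn] h]] := pselect (low n v); last first.
  by exists j => //; rewrite kj ltnS ltnW.
have vn : digit v n != 0 by apply/eqP => v0; apply: hn; apply: lowS.
exists n => //; rewrite ltnSn andbT leqNgt; apply/negP => nk.
by move: vn; rewrite hk ?eqxx.
Qed.

(** Gaussian elimination: the leading term of y is cancelled by an element of X,
and this stops because the remainder ends up in low n, a part of X. *)
Lemma leads_mem n k X Y y : subspace X -> subspace Y -> X `<=` Y ->
  low n `<=` X -> (forall j, (k <= j)%N -> leads Y j -> leads X j) ->
  Y y -> low k y -> X y.
Proof.
move=> sX sY XY nX; have [m] := ubnP (n - k)%N.
elim: m k y => // m IH k y hm hk Yy ky.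
have [nk|kn] := leqP n k; first by apply: nX; apply: low_leq ky.
have IH' z : Y z -> low k.+1 z -> X z.
  apply: IH; first by rewrite -ltnS; apply: leq_trans hm; rewrite ltnS ltn_sub2l.
  by move=> j kj; apply: hk; apply: ltnW.
have [y0|y0] := eqVneq (digit y k) 0; first by apply: IH' => //; apply: lowS.
have [x Xx [lx x0]] : leads X k by apply: hk => //; exists y.
apply: (subspaceDK (v := (digit y k / digit x k) *: x) sX); last exact: subspaceZ.
apply: IH'; last exact: low_cancel.
by apply: subspaceB => //; apply: subspaceZ => //; apply: XY.
Qed.

Lemma tail_subspace X Y k : subspace X -> subspace Y -> subspace (tail X Y k).
Proof.
move=> sX sY; have sl := low_subspace k; split.
  by exists 0; rewrite ?subr0; [split; apply: subspace0|apply: subspace0].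
move=> a u v [y [Yy ly] Xy] [y' [Yy' ly'] Xy']; exists (a *: y + y').
  by split; [apply: sY.2|apply: sl.2].
by rewrite opprD addrACA -scalerBr; apply: sX.2.
Qed.

Lemma tail_sub X Y k : subspace Y -> X `<=` tail X Y k.
Proof.
move=> sY x Xx; exists 0; rewrite ?subr0 //; split; apply: subspace0 => //.
exact: low_subspace.
Qed.

Lemma tail_high n X Y k : subspace X -> subspace Y -> low n `<=` X ->
  (n <= k)%N -> tail X Y k = X.
Proof.
move=> sX sY nX nk; apply/seteqP; split; last exact: tail_sub.
move=> v [y [_ ly] Xy]; apply: (subspaceDK sX Xy); apply: nX.
exact: low_leq ly.
Qed.

Lemma tail0 X Y : subspace X -> subspace Y -> X `<=` Y -> tail X Y 0 = Y.
Proof.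
move=> sX sY XY; apply/seteqP; split=> [v [y [Yy _] Xy]|y Yy].
  by apply: (subspaceDK sY (XY _ Xy)).
by exists y; rewrite ?subrr; [|apply: subspace0].
Qed.

Lemma tail_leq X Y j k : (j <= k)%N -> tail X Y k `<=` tail X Y j.
Proof. by move=> jk v [y [Yy ly] Xy]; exists y => //; split=> //; apply: low_leq ly. Qed.

Lemma tail_skip X Y k : subspace X -> subspace Y -> X `<=` Y ->
  (leads Y k -> leads X k) -> tail X Y k = tail X Y k.+1.
Proof.
move=> sX sY XY h; apply/seteqP; split; last exact: tail_leq.
move=> v [y [Yy ly] Xy]; have [y0|y0] := eqVneq (digit y k) 0.
  by exists y => //; split=> //; apply: lowS.
have [x Xx [lx x0]] : leads X k by apply: h; exists y.
set x' := (digit y k / digit x k) *: x; have Xx' : X x' by apply: subspaceZ.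
exists (y - x'); last by rewrite opprB addrCA; apply: subspaceD.
by split; [apply: subspaceB => //; apply: XY|apply: low_cancel].
Qed.

(** Otherwise w - y, with y of higher position, would be an element of X that
leads at k. *)
Lemma tail_jump X Y k w : subspace X -> subspace Y -> X `<=` Y ->
  Y w -> lead w k -> ~ leads X k -> ~ tail X Y k.+1 w.
Proof.
move=> sX sY XY Yw [lw w0] nX [y [Yy ly] Xy]; apply: nX; exists (w - y) => //.
have ly' := low_leq (leqnSn k) ly.
split; first exact: (subspaceB (low_subspace k)).
by rewrite digitB (ly k) ?subr0.
Qed.

Lemma tail_adjoin X Y k w : subspace X -> subspace Y -> X `<=` Y ->
  Y w -> lead w k -> tail X Y k = adjoin (tail X Y k.+1) w.
Proof.
move=> sX sY XY Yw [lw w0]; have st j := tail_subspace j sX sY.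
apply/seteqP; split=> [v [y [Yy ly] Xy]|].
  exists (digit y k / digit w k); set a := _ / _.
  exists (y - a *: w); first by split; [apply: subspaceB => //; apply: subspaceZ|apply: low_cancel].
  by rewrite opprB addrA subrK.
apply: adjoin_min => //; first exact: tail_leq.
by exists w; rewrite ?subrr; [|apply: subspace0].
Qed.

Lemma tail_codim X Y k w d : subspace X -> subspace Y -> X `<=` Y ->
  Y w -> lead w k -> ~ leads X k ->
  codim (tail X Y k.+1) X d -> codim (tail X Y k) X d.+1.
Proof.
move=> sX sY XY Yw lw nX hd; have st j := tail_subspace j sX sY.
have nw := tail_jump sX sY XY Yw lw nX.
rewrite (tail_adjoin sX sY XY Yw lw) -(add1n d).
apply: (@codim_add _ _ _ (tail X Y k.+1)) => //.
- exact: adjoin_subspace.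
- exact: tail_sub.
- exact: adjoin_sub.
- exact: adjoin_codim.
Qed.

Lemma codim_tail n X Y k : subspace X -> subspace Y -> X `<=` Y ->
  low n `<=` X -> exists d, codim (tail X Y k) X d.
Proof.
move=> sX sY XY nX; have [m] := ubnP (n - k)%N; elim: m k => // m IH k hm.
have [nk|kn] := leqP n k.
  by exists 0; rewrite (tail_high sX sY nX nk); apply: codim_refl.
have [|d hd] := IH k.+1.
  by rewrite -ltnS; apply: leq_trans hm; rewrite ltnS ltn_sub2l.
have [[[w Yw lw] nX']|h] := pselect (leads Y k /\ ~ leads X k).
  by exists d.+1; apply: (tail_codim sX sY XY Yw lw nX' hd).
exists d; rewrite (tail_skip sX sY XY) // => Yk.
by apply: contrapT => Xk; apply: h.
Qed.

(** A basis of Y / X has one element for each leading position of Y that X lacks. *)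
Lemma codim_exists n X Y : subspace X -> subspace Y -> X `<=` Y ->
  low n `<=` X -> exists d, codim Y X d.
Proof.
move=> sX sY XY nX; have [d] := codim_tail 0 sX sY XY nX.
by rewrite tail0 // => h; exists d.
Qed.

End Filtration.

(** A finite set presented by a list without repetition: finiteness, cardinality
and finite-support sums are then read off from the list. *)
(** * Flags with increasing leading positions *)

Definition enumerates (A : eqType) (S : set A) (L : seq A) :=
  uniq L /\ forall x, S x <-> x \in L.

Section Flags.
Context {F : finFieldType} {T : lmodType F} (digit : T -> nat -> F).
Context (digitP : forall a u v k, digit (a *: u + v) k = a * digit u k + digit v k).
Implicit Types (X Y P : set T) (u v w x y : T).
Local Notation low := (low digit).
Local Notation lead := (lead digit).
Local Notation leads := (leads digit).
Local Notation tail := (tail digit).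

(** One step of a flag: X' has one dimension more than X, and the new leading
position is k. *)
Definition ext X X' k :=
  [/\ subspace X', X `<=` X', codim X' X 1, ~ leads X k
    & leads X' = leads X `|` [set k]].

(** The chains X < X_1 < X_2 < ... whose new leading positions increase and
start at or after k.  The tail of such a chain is again one, with a larger
bound, and this allows induction.  The predicate Q restricts the members: to
modules, or to subspaces of a given P. *)
Fixpoint chain (Q : set T -> Prop) k X (s : seq (set T)) : Prop :=
  if s is X1 :: s' then
    exists j, [/\ (k <= j)%N, ext X X1 j, Q X1 & chain Q j.+1 X1 s']
  else True.

(** A vector x + a u that leads before k has the lead of x; one that leads after k
has a = 0, since otherwise x would lead at k. *)
Lemma leads_adjoin X u k : subspace X -> lead u k -> ~ leads X k ->
  leads (adjoin X u) = leads X `|` [set k].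
Proof.
move=> sX [lu u0] nX; have sl j := low_subspace digitP j.
apply/seteqP; split=> [j|j [[v Xv lv]|->]]; last 2 first.
- by exists v => //; apply: (adjoin_sub u).
- by exists u => //; apply: adjoin_mem.
case=> v [a Xa] [lv v0]; have [->|jk] := eqVneq j k; first by right.
left; exists (v - a *: u) => //; case: (ltngtP j k) jk => // jk _.
  have lu' := low_leq (ltnW jk) lu.
  split; first by apply: (subspaceB (sl j)) => //; apply: (subspaceZ _ (sl j)).
  by rewrite digitB ?digitZ ?lu // mulr0 subr0.
have lv' := low_leq (ltnW jk) lv.
have [->|a0] := eqVneq a 0; first by rewrite scale0r subr0.
case: nX; exists (v - a *: u) => //; split.
  by apply: (subspaceB (sl k)) => //; apply: (subspaceZ _ (sl k)).
by rewrite digitB // digitZ // lv // sub0r oppr_eq0 mulf_neq0.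
Qed.

Lemma ext_adjoin X u k : subspace X -> lead u k -> ~ leads X k ->
  ext X (adjoin X u) k.
Proof.
move=> sX lu nX; split=> //; [exact: adjoin_subspace|exact: adjoin_sub| |exact: leads_adjoin].
by apply: adjoin_codim => // Xu; apply: nX; exists u.
Qed.

Lemma extP X X' k : subspace X -> ext X X' k ->
  exists u, [/\ X' u, lead u k & X' = adjoin X u].
Proof.
move=> sX [sX' XX' cX' nX lX']; have [u X'u lu] : leads X' k by rewrite lX'; right.
exists u; split=> //; apply: codim1_adjoin => // Xu; apply: nX; by exists u.
Qed.

(** For w in P leading at k, the extensions of X by the position k are the
X + F (w + b), where b runs over the d-dimensional space of corrections of
position greater than k modulo X. *)
Lemma enum_ext X P k d : subspace X -> subspace P -> X `<=` P ->
  leads P k -> ~ leads X k -> codim (tail X P k.+1) X d ->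
  exists2 L, enumerates [set X' | ext X X' k /\ X' `<=` P] L
    & size L = (#|F| ^ d)%N.
Proof.
move=> sX sP XP [w Pw lw] nX [e [te he]].
have st := tail_subspace digitP k.+1 sX sP.
have sl j := low_subspace digitP j.
have nw := tail_jump digitP sX sP XP Pw lw nX.
have tsum (a : {ffun 'I_d -> F}) : tail X P k.+1 (\sum_i a i *: e i).
  by apply: subspace_sum => // i; apply: subspaceZ.
pose f (a : {ffun 'I_d -> F}) := adjoin X (w + \sum_i a i *: e i).
have fP (a : {ffun 'I_d -> F}) : exists u, [/\ P u, lead u k & f a = adjoin X u].
  have [y [Py ly] Xy] := tsum a; exists (w + y).
  case: lw => lw w0; split; first exact: subspaceD.
    split; last by rewrite digitD // ly // addr0.
    by apply: (subspaceD (sl k)) => //; apply: low_leq ly.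
  apply/seteqP; split; apply: adjoin_min => //; try exact: adjoin_subspace; try exact: adjoin_sub.
    exists 1; rewrite scale1r (_ : _ - _ = \sum_i a i *: e i - y) //.
    by rewrite opprD addrACA subrr add0r.
  exists 1; rewrite scale1r (_ : _ - _ = - (\sum_i a i *: e i - y)); first exact: subspaceN.
  by rewrite opprD addrACA subrr add0r opprB.
exists [seq f a | a <- enum {: {ffun 'I_d -> F}}]; last first.
  by rewrite size_map -cardT card_ffun card_ord.
split.
  rewrite map_inj_uniq ?enum_uniq // => a b fab.
  have [t Xt] : f b (w + \sum_i a i *: e i) by rewrite -fab; apply: adjoin_mem.
  (* the coefficient of w is the digit at k, relative to w *)
  have t1 : t = 1.
    apply/eqP/negP => /negP; rewrite eq_sym -subr_eq0 => t1; apply: nw.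
    apply: (subspaceZK st t1); rewrite scalerBl scale1r.
    apply: (subspaceDK (v := t *: (\sum_i b i *: e i) - \sum_i a i *: e i) st).
      apply: (tail_sub digitP) => //.
      by move: Xt; rewrite opprB scalerDr opprD addrACA.
    by apply: subspaceB => //; apply: subspaceZ.
  move: Xt; rewrite t1 scale1r opprD addrACA subrr add0r => Xt.
  have [c [Xc uc]] := he _ (tsum a).
  by rewrite -(uc a) ?subrr ?(uc b) //; apply: subspace0.
move=> X'; split=> [[hX' X'P]|/mapP[a _ ->]]; last first.
  have [u [Pu lu ->]] := fP a; split; first exact: ext_adjoin.
  exact: adjoin_min.
have [u [X'u [lu u0] X'E]] := extP sX hX'; case: hX' => sX' XX' cX' _ _.
case: lw => lw w0.
(* u rescaled to have the same leading digit as w, so that u' - w leads later *)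
pose u' := (digit w k / digit u k) *: u.
have X'u' : X' u' by apply: subspaceZ.
have tu' : tail X P k.+1 (u' - w).
  exists (u' - w); last by rewrite subrr; apply: subspace0.
  split; first by apply: subspaceB => //; apply: X'P.
  by rewrite -opprB; apply: (subspaceN (sl _)); apply: low_cancel.
have [a [Xa _]] := he _ tu'; apply/mapP; exists a; first by rewrite mem_enum.
apply: codim1_adjoin => //.
  apply: (subspaceDK (v := u') sX') => //; apply: XX'.
  by move: (subspaceN sX Xa); rewrite !opprB addrA [_ + w]addrC.
move=> /(tail_sub digitP k.+1 sP) h; apply: nw.
by rewrite -(addrK (\sum_i a i *: e i) w); apply: subspaceB.
Qed.

(** The element that X' adds to X leads at k, so it only makes up for the step
from k to k+1. *)
Lemma tail_ext X X1 P k : subspace X -> subspace P -> ext X X1 k -> X1 `<=` P ->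
  tail X1 P k.+1 = tail X P k.
Proof.
move=> sX sP eX X1P; have [u [X1u [lu u0] X1E]] := extP sX eX.
case: eX => sX1 XX1 _ _ _; have sl j := low_subspace digitP j.
apply/seteqP; split=> v [y [Py ly] Xy].
  move: Xy; rewrite X1E => -[a Xa]; exists (y + a *: u).
    split; first by apply: subspaceD => //; apply: subspaceZ => //; apply: X1P.
    by apply: (subspaceD (sl k)); [apply: low_leq ly|apply: (subspaceZ _ (sl k))].
  by rewrite opprD addrA.
set b := (digit y k / digit u k) *: u; have X1b : X1 b by apply: subspaceZ.
exists (y - b); last by rewrite opprB addrCA; apply: subspaceD => //; apply: XX1.
by split; [apply: subspaceB => //; apply: X1P|apply: low_cancel].
Qed.

Lemma chainS Q k X s : chain Q k X s <-> chain Q k.+1 X s \/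
  exists X1 s', [/\ s = X1 :: s', ext X X1 k, Q X1 & chain Q k.+1 X1 s'].
Proof.
split.
  case: s => [|X1 s] /=; first by left.
  case=> j [kj eX QX1 cs]; move: kj; rewrite leq_eqVlt => /predU1P[kj|kj].
    by right; exists X1, s; rewrite kj.
  by left; exists j.
case=> [|[X1 [s' [-> eX QX1 cs]]]]; last by exists k.
by case: s => //= X1 s [j [kj eX QX1 cs]]; exists j; split=> //; apply: ltnW.
Qed.

Lemma leads_low n X j u : low n `<=` X -> (n <= j)%N -> lead u j -> leads X j.
Proof.
by move=> nX nj lu; exists u => //; apply: nX; case: lu => lu _; apply: low_leq lu.
Qed.

Lemma ext_inj X X1 j k : ext X X1 j -> ext X X1 k -> j = k.
Proof.
move=> [_ _ _ nj lj] [_ _ _ nk lk].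
have : leads X1 k by rewrite lk; right.
by rewrite lj => -[|->].
Qed.

(** Downward induction on k.  If k is a leading position of P but not of X, a
chain either avoids k, or starts with one of the q^(d-1) extensions of X at k;
the remaining positions are the same in both cases, so the sum is multiplied
by 1 + x q^(d-1).  For any other k nothing changes. *)
Lemma enum_chain (E : comNzRingType) (x : E) n P k X d :
  subspace P -> subspace X -> X `<=` P -> low n `<=` X ->
  codim (tail X P k) X d ->
  exists2 L, enumerates [set s | chain (fun X1 => X1 `<=` P) k X s] L
    & \sum_(s <- L) x ^+ size s = \prod_(i < d) (1 + x * #|F|%:R ^+ i).
Proof.
move=> sP; have [m] := ubnP (n - k)%N; elim: m k X d => // m IH k X d hm sX XP nX hd.
have [nk|kn] := leqP n k.
  move: hd; rewrite (tail_high digitP sX sP nX nk) => hd.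
  rewrite (codim_inj sX sX hd (codim_refl sX)) big_ord0.
  exists [:: [::]]; last by rewrite big_seq1 expr0.
  split=> // -[|X1 s] /=; first by rewrite inE.
  split=> // -[j [kj eX _ _]].
  have [u [_ lu _]] := extP sX eX; case: eX => _ _ _ [].
  exact: leads_low nX (leq_trans nk kj) lu.
have {}IH X' d' : subspace X' -> X' `<=` P -> low n `<=` X' ->
    codim (tail X' P k.+1) X' d' -> exists2 L,
    enumerates [set s | chain (fun X1 => X1 `<=` P) k.+1 X' s] L &
    \sum_(s <- L) x ^+ size s = \prod_(i < d') (1 + x * #|F|%:R ^+ i).
  by apply: IH; rewrite -ltnS; apply: leq_trans hm; rewrite ltnS ltn_sub2l.
have [[lP nlX]|h] := pselect (leads P k /\ ~ leads X k); last first.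
  move: hd; rewrite (tail_skip digitP sX sP XP); last first.
    by move=> Pk; apply: contrapT => Xk; apply: h.
  move=> /(IH X d sX XP nX)[L [uL hL] sL]; exists L => //; split=> // s.
  split=> [|/hL hs]; last by apply/chainS; left.
  case/chainS => [hs|[X1 [s' [_ eX X1P _]]]]; first exact/hL.
  have [u [X1u lu _]] := extP sX eX; case: h; case: eX => _ _ _ nl _.
  by split=> //; exists u => //; apply: X1P.
have st j := tail_subspace digitP j sX sP.
have [d' hd'] := codim_tail digitP k.+1 sX sP XP nX.
have [w Pw lw] := lP.
have hd'' := tail_codim digitP sX sP XP Pw lw nlX hd'.
rewrite (codim_inj sX (st k) hd hd'') {d hd}.
have [L1 [uL1 hL1] sL1] := IH X d' sX XP nX hd'.
have [LX [uLX hLX] sLX] := enum_ext sX sP XP lP nlX hd'.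
have Lext X1 : X1 \in LX -> exists2 L,
    enumerates [set s | chain (fun X1 => X1 `<=` P) k.+1 X1 s] L &
    \sum_(s <- L) x ^+ size s = \prod_(i < d') (1 + x * #|F|%:R ^+ i).
  move=> /hLX[eX X1P]; have [sX1 XX1 cX1 _ _] := eX.
  have nX1 : low n `<=` X1 by move=> v /nX /XX1.
  have tE := tail_ext sX sP eX X1P.
  have [d1 hd1] := codim_tail digitP k.+1 sX1 sP X1P nX1.
  apply: IH => //; move: (hd1); rewrite tE => hd1'.
  have : d'.+1 = (d1 + 1)%N.
    apply: codim_inj hd'' _ => //; apply: codim_add hd1' cX1 => //.
    by rewrite -tE; apply: tail_sub.
  by rewrite addn1 => -[->]; rewrite -tE.
have /choice[g gP] : forall X1, exists L, X1 \in LX ->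
    enumerates [set s | chain (fun X1 => X1 `<=` P) k.+1 X1 s] L /\
    \sum_(s <- L) x ^+ size s = \prod_(i < d') (1 + x * #|F|%:R ^+ i).
  move=> X1; have [/Lext[L h1 h2]|] := boolP (X1 \in LX); first by exists L.
  by exists [::].
exists (L1 ++ [seq X1 :: s | X1 <- LX, s <- g X1]); last first.
  have gsum : \sum_(X1 <- LX) \sum_(s <- g X1) x ^+ size (X1 :: s) =
      \sum_(X1 <- LX) x * \prod_(i < d') (1 + x * #|F|%:R ^+ i).
    apply: eq_big_seq => X1 X1L; have [_ <-] := gP X1 X1L.
    by rewrite mulr_sumr; apply: eq_bigr => s _; rewrite exprS.
  rewrite big_cat /= big_allpairs_dep sL1 gsum.
  rewrite big_const_seq count_predT sLX iter_addr_0 big_ord_recr /=.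
  by rewrite mulrDr mulr1 [in RHS]mulrC -mulrA -natrX mulrA mulr_natr mulrnAl.
split.
  rewrite cat_uniq uL1 /=; apply/andP; split.
    apply/hasPn => s /allpairsPdep[X1 [s' [X1L _ ->]]]; apply/negP => /hL1 /=.
    case=> j [kj ej _ _]; have [ek _] := (hLX X1).2 X1L.
    by move: kj; rewrite (ext_inj ej ek) ltnn.
  apply: allpairs_uniq_dep => //; first by move=> X1 X1L; have [[]] := gP X1 X1L.
  by move=> [X1 s1] [X2 s2] _ _ /= [-> ->].
move=> s; rewrite mem_cat; split.
  move=> /chainS[/hL1 ->//|[X1 [s' [-> eX X1P cs]]]].
  have X1L : X1 \in LX by apply/hLX.
  apply/orP; right; apply/allpairsPdep; exists X1, s'; split=> //.
  by have [[_ hg] _] := gP X1 X1L; apply/hg.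
case/orP => [/hL1 h|/allpairsPdep[X1 [s' [X1L s'L ->]]]]; apply/chainS; first by left.
right; exists X1, s'; have [eX X1P] := (hLX X1).2 X1L; split=> //.
by have [[_ hg] _] := gP X1 X1L; apply/hg.
Qed.

Lemma chain_last P k X s : subspace X -> X `<=` P ->
  chain (fun X1 => X1 `<=` P) k X s ->
  [/\ subspace (last X s), X `<=` last X s, last X s `<=` P
    & codim (last X s) X (size s)].
Proof.
elim: s k X => [|X1 s IH] k X sX XP /=; first by split=> //; apply: codim_refl.
case=> j [_ [sX1 XX1 cX1 _ _] X1P /(IH _ _ sX1 X1P)[sl X1l lP cl]]; split=> //.
  by move=> v /XX1 /X1l.
by rewrite -addn1; apply: codim_add cl cX1.
Qed.
End Flags.

(** * Subspaces transverse to a given subspace *)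

Section Transverse.
Context {F : finFieldType} {T : lmodType F} (digit : T -> nat -> F).
Context (digitP : forall a u v k, digit (a *: u + v) k = a * digit u k + digit v k).
Implicit Types (X Y K M N : set T) (u v w x y f : T).

(** Fix a basis e of M1 modulo X + F f.  The hyperplanes of M1 that contain X but
not f are X + span (e_i + a_i f), one for each vector a. *)
Lemma enum_complement X f M1 k : subspace X -> ~ X f -> subspace M1 ->
  adjoin X f `<=` M1 -> codim M1 (adjoin X f) k ->
  exists2 L, enumerates
      [set M | [/\ subspace M, X `<=` M, ~ M f & adjoin M f = M1]] L
    & size L = (#|F| ^ k)%N.
Proof.
move=> sX Xf sM1 XM1 [e [M1e he]].
have sX1 := adjoin_subspace f sX; have M1f : M1 f by apply: XM1; apply: adjoin_mem.
pose h (a : {ffun 'I_k -> F}) : set T :=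
  [set v | exists b : {ffun 'I_k -> F}, X (v - \sum_i b i *: (e i + a i *: f))].
have hs (a : {ffun 'I_k -> F}) : subspace (h a).
  split.
    exists [ffun=> 0]; rewrite big1 ?subr0; first exact: subspace0.
    by move=> i _; rewrite ffunE scale0r.
  move=> t u v [b Xb] [b' Xb']; exists [ffun i => t * b i + b' i].
  rewrite (_ : \sum_i _ = t *: (\sum_i b i *: (e i + a i *: f)) +
      \sum_i b' i *: (e i + a i *: f)).
    by rewrite opprD addrACA -scalerBr; apply: sX.2.
  rewrite scaler_sumr -big_split /=; apply: eq_bigr => i _.
  by rewrite ffunE scalerDl scalerA.
have hX (a : {ffun 'I_k -> F}) : X `<=` h a.
  move=> v Xv; exists [ffun=> 0]; rewrite big1 ?subr0 // => i _.
  by rewrite ffunE scale0r.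
have he_mem (a : {ffun 'I_k -> F}) i : h a (e i + a i *: f).
  exists [ffun j => (j == i)%:R]; rewrite (bigD1 i) //= ffunE eqxx scale1r big1.
    by rewrite addr0 subrr; apply: subspace0.
  by move=> j ji; rewrite ffunE (negbTE ji) scale0r.
have sumE (a b : {ffun 'I_k -> F}) : \sum_i b i *: (e i + a i *: f) =
    \sum_i b i *: e i + (\sum_i b i * a i) *: f.
  rewrite scaler_suml -big_split /=; apply: eq_bigr => i _.
  by rewrite scalerDr scalerA.
have hf (a : {ffun 'I_k -> F}) : ~ h a f.
  move=> [b]; rewrite sumE => Xb; have b0 : b = [ffun=> 0].
    apply: codim_free he _ => //.
    exists (1 - \sum_i b i * a i); rewrite scalerBl scale1r opprB addrCA.
    move: (subspaceN sX Xb); rewrite opprB addrAC; congr X.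
    by rewrite [RHS]addrCA [RHS]addrA addrAC.
  apply: Xf; move: Xb; rewrite b0 !big1 ?scale0r ?addr0 ?subr0 //.
    by move=> i _; rewrite ffunE mul0r.
  by move=> i _; rewrite ffunE scale0r.
have hM1 (a : {ffun 'I_k -> F}) : adjoin (h a) f = M1.
  apply/seteqP; split.
    apply: adjoin_min => // v [b Xb]; apply: (subspaceDK sM1).
      by apply: XM1; apply: adjoin_sub; exact: Xb.
    apply: subspace_sum => // i; apply: subspaceZ => //; apply: subspaceD => //; exact: subspaceZ.
  move=> v /he[b [[t Xt] _]]; exists (t - \sum_i b i * a i), b.
  rewrite sumE scalerBl opprB [_ - t *: f]addrC addrA.
  by rewrite [\sum_i _ + _]addrC addrKA addrAC.
exists [seq h a | a <- enum {: {ffun 'I_k -> F}}]; last first.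
  by rewrite size_map -cardT card_ffun card_ord.
split.
  rewrite map_inj_uniq ?enum_uniq // => a b hab; apply/ffunP => i.
  apply/eqP/negP => /negP; rewrite -subr_eq0 => ab; apply: (hf a).
  apply: (subspaceZK (hs a) ab); rewrite scalerBl.
  rewrite (_ : _ - _ = (e i + a i *: f) - (e i + b i *: f)).
    by apply: subspaceB; rewrite ?[in X in X (_ + b i *: f)]hab //; apply: he_mem.
  by rewrite opprD addrACA subrr add0r.
move=> M; split=> [[sM XM Mf adjM]|/mapP[a _ ->]]; last by split.
have /choice[l Ml] : forall i, exists t, M (e i - t *: f).
  by move=> i; have := M1e i; rewrite -adjM.
pose a := [ffun i => - l i]; apply/mapP; exists a; first by rewrite mem_enum.
have ha : h a `<=` M.
  move=> v [b Xb]; apply: (subspaceDK sM (XM _ Xb)).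
  by apply: subspace_sum => // i; apply: subspaceZ => //; rewrite ffunE scaleNr.
apply/seteqP; split=> // v Mv.
have : adjoin (h a) f v by rewrite hM1 -adjM; apply: adjoin_sub.
case=> t ht; have [t0|t0] := eqVneq t 0; first by move: ht; rewrite t0 scale0r subr0.
case: Mf; apply: (subspaceZK sM t0).
by rewrite -[t *: f](subKr v); apply: subspaceB => //; apply: ha.
Qed.

(** The recursion splits the subspaces M according to whether they contain a
chosen vector f; if not, M is a complement of f in the transverse subspace
M + F f, whose codimension is one less. *)
Fixpoint transverse_count q c r d : nat :=
  match r, d with
  | 0, 0 => 1
  | 0, _.+1 => 0
  | r'.+1, 0 => transverse_count q c r' 0
  | r'.+1, d'.+1 => transverse_count q c r' d'.+1
                    + q ^ (c + r' - d') * transverse_count q c r' d'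
  end.

Definition transverse X K N d : set (set T) :=
  [set M | [/\ subspace M, X `<=` M, M `<=` N, codim N M d
    & forall v, N v -> exists2 m, M m & K (v - m)]].

(** Induction on r, with f in K outside X replacing X by X + F f.  Adjoining f to
M, or removing it, keeps M + K = N because f lies in K; and M + F f has
dimension c + r - d modulo X + F f, for N / (X + F f) of dimension c + r and
M of codimension d + 1. *)
Lemma enum_transverse n X K N c r d : subspace X -> subspace K -> subspace N ->
  low digit n `<=` X -> X `<=` K -> K `<=` N -> codim N K c -> codim K X r ->
  exists2 L, enumerates (transverse X K N d) L
    & size L = transverse_count #|F| c r d.
Proof.
move=> + sK sN + + KN cK; elim: r X d => [|r IH] X d sX nX XK cX.
  have KX := codim0 sX cX.
  have MN M : transverse X K N d M -> M = N.
    move=> [sM XM MN _ h]; apply/seteqP; split=> // v /h[m Mm Kv].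
    by apply: (subspaceDK sM _ Mm); apply: XM; apply: KX.
  case: d MN => [|d] MN.
    exists [:: N] => //; split=> // M; rewrite inE; split=> [/MN ->//|/eqP ->].
    split=> //; first by move=> v /XK /KN.
      exact: codim_refl.
    by move=> v Nv; exists v; rewrite ?subrr //; apply: subspace0.
  exists [::] => //; split=> // M; split=> // hM; have ME := MN M hM.
  by case: hM => _ _ _ + _; rewrite ME => /(codim_inj sN sN (codim_refl sN)).
have [f Kf Xf] : exists2 f, K f & ~ X f.
  apply: contrapT => h; have KX : K = X.
    apply/seteqP; split=> // v Kv; apply: contrapT => Xv; apply: h; by exists v.
  by move: cX; rewrite KX => /(codim_inj sX sX (codim_refl sX)).
pose X1 := adjoin X f; have sX1 : subspace X1 by apply: adjoin_subspace.
have XX1 : X `<=` X1 by apply: adjoin_sub.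
have X1K : X1 `<=` K by apply: adjoin_min.
have nX1 : low digit n `<=` X1 by move=> v /nX /XX1.
have cX1 : codim K X1 r.
  have [r' hr'] := codim_exists digitP sX1 sK X1K nX1.
  have := codim_add sX sX1 sK XX1 X1K hr' (adjoin_codim sX Xf).
  by rewrite addn1 => /(codim_inj sX sK cX)[->].
have {}IH d' := IH X1 d' sX1 nX1 X1K cX1.
have NX1 : X1 `<=` N by move=> v /X1K /KN.
have tsub d' M : transverse X1 K N d' M -> transverse X K N d' M.
  by move=> [sM X1M MN cM tM]; split=> // v /XX1 /X1M.
have tf d' M : transverse X K N d' M -> M f -> transverse X1 K N d' M.
  by move=> [sM XM MN cM tM] Mf; split=> //; apply: adjoin_min.
case: d => [|d].
  have [L [uL hL] sL] := IH 0; exists L => //; split=> // M; split=> [hM|/hL /tsub //].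
  apply/hL; apply: tf => //; case: hM => sM _ _ cM _.
  by apply: (codim0 sM cM); apply: KN.
have [L0 [uL0 hL0] sL0] := IH d.+1; have [L1 [uL1 hL1] sL1] := IH d.
have /choice[g gP] : forall M1, exists L, M1 \in L1 -> enumerates
    [set M | [/\ subspace M, X `<=` M, ~ M f & adjoin M f = M1]] L /\
    size L = (#|F| ^ (c + r - d))%N.
  move=> M1; have [/hL1[sM1 X1M1 M1N cM1 _]|] := boolP (M1 \in L1); last by exists [::].
  have [k hk] := codim_exists digitP sX1 sM1 X1M1 nX1.
  have [L hL sL] := enum_complement sX Xf sM1 X1M1 hk.
  exists L => _; split=> //; rewrite sL; congr (_ ^ _)%N.
  have h1 := codim_add sX1 sM1 sN X1M1 M1N cM1 hk.
  have h2 := codim_add sX1 sK sN X1K KN cK cX1.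
  by rewrite (codim_inj sX1 sN h2 h1) addKn.
exists (L0 ++ [seq M | M1 <- L1, M <- g M1]); last first.
  rewrite size_cat size_allpairs_dep sL0 /=; congr addn.
  rewrite -sL1 sumnE big_map.
  rewrite (eq_big_seq (fun=> (#|F| ^ (c + r - d))%N)); last by move=> M1 /gP[].
  by rewrite big_const_seq count_predT iter_addn_0.
split.
  rewrite cat_uniq uL0 /=; apply/andP; split.
    apply/hasPn => M /allpairsPdep[M1 [M' [M1L + ->]]].
    have [[_ hg] _] := gP M1 M1L => /hg[_ _ Mf _].
    by apply/negP => /hL0[_ X1M _ _ _]; apply: Mf; apply: X1M; apply: adjoin_mem.
  apply: allpairs_uniq_dep => //; first by move=> M1 M1L; have [[]] := gP M1 M1L.
  move=> [M1 M] [M1' M'] /allpairsPdep[N1 [N2 [h1 h2 [-> ->]]]].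
  move=> /allpairsPdep[N1' [N2' [h1' h2' [-> ->]]]] /= NN; rewrite NN in h2 *.
  have [[_ hg] _] := gP _ h1; have [[_ hg'] _] := gP _ h1'.
  by have [_ _ _ <-] := (hg _).2 h2; have [_ _ _ <-] := (hg' _).2 h2'.
move=> M; rewrite mem_cat; split.
  move=> hM; have [Mf|Mf] := pselect (M f).
    by rewrite (hL0 M).1 //; apply: tf.
  apply/orP; right; have [sM XM MN cM tM] := hM.
  have sM1 := adjoin_subspace f sM.
  have M1N : adjoin M f `<=` N by apply: adjoin_min => //; apply: KN.
  have nM1 : low digit n `<=` adjoin M f by move=> v /nX /XM; apply: adjoin_sub.
  have M1L : adjoin M f \in L1.
    apply/hL1; split=> //.
    - by apply: adjoin_min; [|move=> v /XM; apply: adjoin_sub|apply: adjoin_mem].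
    - have [d' hd'] := codim_exists digitP sM1 sN M1N nM1.
      have := codim_add sM sM1 sN (@adjoin_sub _ _ M f) M1N hd' (adjoin_codim sM Mf).
      by rewrite addn1 => /(codim_inj sM sN cM)[->].
    by move=> v /tM[m Mm Kv]; exists m => //; apply: adjoin_sub.
  apply/allpairsPdep; exists (adjoin M f), M; split=> //.
  by have [[_ hg] _] := gP _ M1L; apply/hg.
case/orP=> [/hL0 /tsub //|/allpairsPdep[M1 [M' [M1L + ->]]]].
have [[_ hg] _] := gP M1 M1L => /hg {hg}[sM XM Mf M1E].
have [sM1 X1M1 M1N cM1 tM1] := (hL1 M1).2 M1L.
split=> //; first by move=> v Mv; apply: M1N; rewrite -M1E; apply: adjoin_sub.
  rewrite -addn1; apply: codim_add cM1 _ => //; rewrite -M1E.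
    exact: adjoin_sub.
  exact: adjoin_codim.
move=> v /tM1[m1]; rewrite -M1E => -[t Mt] Kv; exists (m1 - t *: f) => //.
by rewrite opprB addrCA; apply: subspaceD => //; apply: subspaceZ.
Qed.
End Transverse.

(** * Power series and the coordinates of Omega *)

Section Series.
Context {F : finFieldType}.
Implicit Types (f g r : fps F).

Lemma coef_fpszM g n : (fpsz * g) n = if n is m.+1 then g m else 0.
Proof.
rewrite /GRing.mul /=; case: n => [|n].
  by rewrite big_ord_recl big_ord0 /= mul0r addr0.
rewrite big_ord_recl big_ord_recl /= mul0r add0r mul1r subn1 big1 ?addr0 // => i _.
by rewrite mul0r.
Qed.

Lemma coef_fpszXM N g n : (fpsz ^+ N * g) n = if (n < N)%N then 0 else g (n - N)%N.
Proof.
elim: N n => [|N IH] n; first by rewrite expr0 mul1r subn0.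
by rewrite exprS -mulrA coef_fpszM; case: n => [|n] //; rewrite IH ltnS.
Qed.

Lemma fpsz_dvd f : (exists g, f = fpsz * g) <-> f 0%N = 0.
Proof.
split=> [[g ->]|f0]; first by rewrite coef_fpszM.
by exists (Fps (fun n => f n.+1)); apply: fpsP => -[|n]; rewrite coef_fpszM.
Qed.

Lemma coef_algM (a : F) f n : (a%:A * f) n = a * f n.
Proof. by rewrite mulr_algl. Qed.

Lemma fps_coefB f g n : (f - g) n = f n - g n. Proof. by []. Qed.

Lemma coef_alg0 (a : F) : (a%:A : fps F) 0%N = a.
Proof. by rewrite -[a%:A]mulr1 coef_algM mulr1. Qed.

Lemma algM (a b : F) : (a * b)%:A = a%:A * b%:A :> fps F.
Proof. by rewrite mulr_algl scalerA. Qed.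

End Series.

(** [Omega F c] with constant series as scalars.  It has its own name because
[Omega F c] already carries a scaling by power series. *)
Definition OmegaF (F : finFieldType) c := Omega F c.

HB.instance Definition _ (F : finFieldType) c := GRing.Zmodule.on (OmegaF F c).

Section OmegaLmodule.
Context {F : finFieldType} {c : nat}.

Definition OmegaF_scale (a : F) (v : OmegaF F c) : OmegaF F c :=
  (a%:A : fps F) *: (v : Omega F c).

Lemma OmegaF_scaleA a b v :
  OmegaF_scale a (OmegaF_scale b v) = OmegaF_scale (a * b) v.
Proof. by rewrite /OmegaF_scale scalerA algM. Qed.

Lemma OmegaF_scale1 : left_id 1 OmegaF_scale.
Proof. by move=> v; rewrite /OmegaF_scale scale1r; apply: scale1r. Qed.

Lemma OmegaF_scaleDr : right_distributive OmegaF_scale +%R.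
Proof. by move=> a u v; apply: scalerDr. Qed.

Lemma OmegaF_scaleDl v : {morph OmegaF_scale^~ v : a b / a + b}.
Proof. by move=> a b; rewrite /OmegaF_scale scalerDl; apply: scalerDl. Qed.

HB.instance Definition _ := GRing.Zmodule_isLmodule.Build F (OmegaF F c)
  OmegaF_scaleA OmegaF_scale1 OmegaF_scaleDr OmegaF_scaleDl.
End OmegaLmodule.

Section Coordinates.
Context {F : finFieldType} {c : nat} (c_gt0 : (0 < c)%N).
Implicit Types (u v w : Omega F c) (M : set (Omega F c)) (r : fps F).

(** The coefficient of z^n eps_i is the digit at position n * c + i. *)
Definition digit (v : OmegaF F c) (k : nat) : F :=
  (v : Omega F c) ord0 (Ordinal (ltn_pmod k c_gt0)) (k %/ c)%N.

Lemma digitE v (i : 'I_c) n : digit v (n * c + i) = v ord0 i n.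
Proof.
rewrite /digit divnMDl // divn_small ?ltn_ord // addn0; congr (fps_coef _ _).
by congr (v _ _); apply: val_inj; rewrite /= modnMDl modn_small ?ltn_ord.
Qed.

Lemma digit_linear (a : F) (u v : OmegaF F c) k :
  digit (a *: u + v) k = a * digit u k + digit v k.
Proof.
by rewrite /digit mxE; congr (_ + _); rewrite [X in fps_coef X]mxE coef_algM.
Qed.

Lemma digit_sum d (b : {ffun 'I_d -> F}) (e : 'I_d -> OmegaF F c) k :
  digit (\sum_i b i *: e i) k = \sum_i b i * digit (e i) k.
Proof.
elim/big_ind2: _ => //; first exact: digit0 digit_linear k.
  by move=> u x v y <- <-; rewrite (digitD digit_linear).
by move=> i _; rewrite (digitZ digit_linear).
Qed.

(** Multiplication by z shifts positions by c, so r acts by a convolution in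
steps of c. *)
Lemma digitM r v j :
  digit (r *: v) j = \sum_(s < (j %/ c).+1) r s * digit v (j - s * c).
Proof.
rewrite {1}/digit mxE; apply: eq_bigr => s _; congr (_ * _).
have sj : (s <= j %/ c)%N by rewrite -ltnS.
have -> : (j - s * c = (j %/ c - s) * c + j %% c)%N.
  by rewrite {1}(divn_eq j c) mulnBl addnBAC // leq_mul2r sj orbT.
by rewrite -(digitE v (Ordinal (ltn_pmod j c_gt0))).
Qed.

Lemma low_mulz k r v : r 0%N = 0 -> low digit k v -> low digit (k + c) (r *: v).
Proof.
move=> r0 lv j jk; rewrite digitM big1 // => -[[|s] sj] _ /=.
  by rewrite r0 mul0r.
rewrite lv ?mulr0 // mulSn subnDA.
apply: leq_ltn_trans (leq_subr _ _) _.
rewrite ltn_subLR ?[(c + k)%N]addnC //.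
by apply: leq_trans (leq_trunc_div j c); rewrite leq_pmull //; case: (j %/ c)%N sj.
Qed.

(** The step N * c of the filtration is z^N [Omega]. *)
Lemma low_zpow N v : low digit (N * c) v <-> exists w, v = fpsz ^+ N *: w.
Proof.
split=> [lv|[w ->] j jN].
  exists (\row_i Fps (fun n => v ord0 i (n + N)%N)); apply/rowP => i.
  rewrite mxE mxE; apply: fpsP => n; rewrite coef_fpszXM.
  have [nN|Nn] := ltnP n N; last by rewrite /= subnK.
  rewrite -(digitE v i) lv //; apply: leq_trans (leq_mul nN (leqnn c)).
  by rewrite mulSn addnC ltn_add2r.
by rewrite /digit mxE coef_fpszXM ltn_divLR // jN.
Qed.

Lemma low_zpow_mul k N v : low digit k v -> low digit (k + N * c) (fpsz ^+ N *: v).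
Proof.
move=> lv; elim: N => [|N IH]; first by rewrite addn0 expr0 scale1r.
rewrite exprS -scalerA mulSn addnA addnAC; exact: low_mulz IH.
Qed.

Lemma lead_nonzero v : v != 0 -> exists k, lead digit v k.
Proof.
move=> v0; have [k vk] : exists k, digit v k != 0.
  apply: contrapT => h; move/eqP: v0; apply; apply/rowP => i; rewrite mxE.
  apply: fpsP => n; rewrite -(digitE v i); apply/eqP/negP => /negP vk.
  by apply: h; eexists; exact: vk.
have l0 : low digit 0 v by [].
have lk : ~ low digit k.+1 v.
  by move=> /(_ k (leqnn _)) /eqP; rewrite (negbTE vk).
have [j _ lj] := lead_exists l0 lk.
by exists j.
Qed.

Lemma lead_neq0 v k : lead digit v k -> v != 0.
Proof. by move=> [_]; apply: contra => /eqP ->; rewrite (digit0 digit_linear). Qed.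

End Coordinates.

(** * Valuations and leading positions *)

Section Valuation.
Context {F : finFieldType} {R : realType} {c : nat} (c_gt0 : (0 < c)%N).
Context (nu : 'I_c -> R).
Context (nu_first : forall i : 'I_c, val i = 0%N -> nu i = 0).
Context (nu_incr : forall i j : 'I_c, (i < j)%N -> nu i < nu j).
Context (nu_lt1 : forall i : 'I_c, nu i < 1).
Implicit Types (v : Omega F c) (M : set (Omega F c)).
Local Notation digit := (@digit F c c_gt0).

(** The valuation n + nu_i of the monomial at position n * c + i. *)
Definition posval (k : nat) : R :=
  (k %/ c)%:R + nu (Ordinal (ltn_pmod k c_gt0)).

(** Within one power of z the [nu i] increase with i; from one power to the next
they cannot catch up because they lie in [0, 1). *)
Lemma posval_lt : {homo posval : j k / (j < k)%N >-> j < k}.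
Proof.
have nu_ge0 i : 0 <= nu i.
  have [i0|i_gt0] := posnP i; first by rewrite nu_first.
  by rewrite -(nu_first (i := Ordinal c_gt0)) // ltW // nu_incr.
move=> j k jk; have : (j %/ c <= k %/ c)%N by apply: leq_div2r; apply: ltnW.
rewrite leq_eqVlt /posval => /predU1P[E|lt_jk].
  rewrite E ltrD2l; apply: nu_incr => /=.
  by move: jk; rewrite {1}(divn_eq j c) {1}(divn_eq k c) E ltn_add2l.
apply: (@lt_le_trans _ _ ((j %/ c).+1)%:R); last first.
  by rewrite -[leLHS]addr0 lerD // ler_nat.
by rewrite -natr1 ltrD2l.
Qed.

Lemma posval_le j k : (posval j <= posval k) = (j <= k)%N.
Proof.
by apply/idP/idP; [|rewrite leq_eqVlt => /predU1P[->//|/posval_lt/ltW//]];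
  rewrite leNgt leqNgt; apply: contra; apply: posval_lt.
Qed.

Lemma posval_inj : injective posval.
Proof.
by move=> j k jk; apply/eqP; rewrite eqn_leq -!posval_le jk lexx.
Qed.

Lemma val_lead v k : lead digit v k -> val_Omega nu v = (posval k)%:E.
Proof.
move=> [lv vk].
have ival n (i : 'I_c) : posval (n * c + i) = n%:R + nu i.
  rewrite /posval divnMDl // divn_small ?ltn_ord // addn0; congr (_ + nu _).
  by apply: val_inj; rewrite /= modnMDl modn_small.
apply/le_anti/andP; split.
  pose i0 := Ordinal (ltn_pmod k c_gt0).
  apply: (le_trans (bigmin_le_cond _ (j := i0) _ _)) => //.
  rewrite /valz; case: pselect => [h|]; last by case; exists (k %/ c)%N.
  rewrite -EFinD lee_fin lerD2r ler_nat; case: ex_minnP => m _; exact.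
apply/bigmin_geP; split=> [|i _]; first exact: leey.
rewrite /valz; case: pselect => [h|_]; last by rewrite leey.
case: ex_minnP => m; rewrite -(digitE c_gt0) => vm _.
rewrite -EFinD -ival lee_fin posval_le leqNgt; apply/negP => /lv /eqP.
by rewrite (negbTE vm).
Qed.

Lemma Delta_leads M : Delta nu M = posval @` leads digit M.
Proof.
apply/seteqP; split=> [x [v [Mv v0 vx]]|x [k [v Mv lv] <-]].
  have [k lk] := lead_nonzero c_gt0 v0; exists k; first by exists v.
  by move: vx; rewrite (val_lead lk) => -[].
by exists v; split=> //; [exact: lead_neq0 lv|exact: val_lead].
Qed.

Lemma Delta_mem M k : Delta nu M (posval k) <-> leads digit M k.
Proof.
rewrite Delta_leads; split=> [[j lj /posval_inj <- //]|lk]; by exists k.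
Qed.

(** Since [posval] is injective, the new element g_i of a flag step corresponds
to exactly one new leading position. *)
Lemma Delta_add M M' k : Delta nu M' = Delta nu M `|` [set posval k] <->
  leads digit M' = leads digit M `|` [set k].
Proof.
split=> E; last by rewrite !Delta_leads E image_setU image_set1.
apply/seteqP; split=> j /=.
  by move/Delta_mem; rewrite E => -[/Delta_mem|/posval_inj]; [left|right].
by case=> [/Delta_mem h|->]; apply/Delta_mem; rewrite E; [left|right].
Qed.

End Valuation.

(** * Modules over a singularity ring *)

Section Modules.
Context {F : finFieldType} {c : nat} (c_gt0 : (0 < c)%N).
Implicit Types (u v w : Omega F c) (M N W : set (Omega F c)) (I : set (fps F)).
Local Notation digit := (@digit F c c_gt0).
Local Notation subspace := (@subspace F (OmegaF F c)).
Local Notation codim := (@codim F (OmegaF F c)).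

Let dlin := @digit_linear F c c_gt0.

Lemma smul_min I M W : W 0 -> (forall u v, W u -> W v -> W (u + v)) ->
  (forall r u, I r -> M u -> W (r *: u)) -> smul I M `<=` W.
Proof.
move=> W0 WD WZ v [n [r [u [Ir Mu ->]]]].
by elim/big_ind: _ => // i _; apply: WZ.
Qed.

Lemma smul_mem I M r u : I r -> M u -> smul I M (r *: u).
Proof.
by move=> Ir Mu; exists 1%N, (fun=> r), (fun=> u); rewrite big_ord1.
Qed.

Lemma smul0 I M : smul I M 0.
Proof. by exists 0%N, (fun=> 0), (fun=> 0); rewrite big_ord0; split=> // -[]. Qed.

Lemma smulD I M u v : smul I M u -> smul I M v -> smul I M (u + v).
Proof.
move=> [n [r [x [Ir Mx ->]]]] [m [s [y [Is My ->]]]].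
exists (n + m)%N, (fun i => match fintype.split i with inl j => r j | inr j => s j end),
  (fun i => match fintype.split i with inl j => x j | inr j => y j end); split.
- by move=> k; case: (fintype.split k).
- by move=> k; case: (fintype.split k).
rewrite big_split_ord /=; congr (_ + _); apply: eq_bigr => i _.
  by rewrite (unsplitK (inl i)).
by rewrite (unsplitK (inr i)).
Qed.

Lemma smulZ I M g v : (forall r, I r -> I (g * r)) -> smul I M v -> smul I M (g *: v).
Proof.
move=> Ig [n [r [u [Ir Mu ->]]]]; exists n, (fun k => g * r k), u; split=> //.
  by move=> k; apply: Ig.
by rewrite scaler_sumr; apply: eq_bigr => k _; rewrite scalerA.
Qed.

Section Ring.
Context (A : set (fps F)) (hA : unibranch A).
Implicit Types r s : fps F.

Let sA : GRing.subalg_closed [in A]. Proof. by case: hA. Qed.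

Let memA x : x \in [in A] <-> A x.
Proof. by split=> [h|h]; [exact: set_mem h|exact: mem_set h]. Qed.

Lemma unibranch1 : A 1.
Proof. by case: sA => /memA. Qed.

Lemma unibranchL (a : F) r s : A r -> A s -> A (a *: r + s).
Proof. by case: sA => _ h _ /memA Ar /memA As; apply/memA/h. Qed.

Lemma unibranchM r s : A r -> A s -> A (r * s).
Proof. by case: sA => _ _ h /memA Ar /memA As; apply/memA/h. Qed.

Lemma unibranch_alg (a : F) : A a%:A.
Proof.
have A0 : A 0 by have := unibranchL (-1) unibranch1 unibranch1; rewrite scaleN1r addNr.
by have := unibranchL a unibranch1 A0; rewrite addr0.
Qed.

Lemma maxidealP r : maxideal A r <-> A r /\ r 0%N = 0.
Proof. by split=> -[Ar /fpsz_dvd h]; split=> //; apply/fpsz_dvd. Qed.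

Lemma maxidealM r s : A r -> maxideal A s -> maxideal A (r * s).
Proof.
move=> Ar /maxidealP[As s0]; apply/maxidealP; split; first exact: unibranchM.
by rewrite /GRing.mul /= big_ord1 s0 mulr0.
Qed.

(** The ring is F_q + m, the splitting that reduces module structures to scalars
and to the action of m. *)
Lemma maxideal_dec r : A r -> maxideal A (r - (r 0%N)%:A).
Proof.
move=> Ar; apply/maxidealP; split; last by rewrite fps_coefB coef_alg0 subrr.
by have := unibranchL (-1) (unibranch_alg (r 0%N)) Ar; rewrite scaleN1r addrC.
Qed.

Lemma submodule_subspace M : submodule A M -> subspace M.
Proof.
move=> [M0 MD MZ]; split=> // a u v Mu Mv; apply: MD => //.
by apply: MZ => //; apply: unibranch_alg.
Qed.

Lemma smul_maxideal_subspace M : subspace (smul (maxideal A) M).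
Proof.
split; first exact: smul0.
move=> a u v Mu Mv; apply: smulD => //; apply: (smulZ (g := a%:A)) => // r.
by apply: maxidealM; apply: unibranch_alg.
Qed.

Lemma smul_maxideal_sub M : submodule A M -> smul (maxideal A) M `<=` M.
Proof.
move=> [M0 MD MZ]; apply: smul_min => // r u [Ar _]; exact: MZ.
Qed.

Lemma smul_maxideal_low M : smul (maxideal A) M `<=` low digit c.
Proof.
have sl := low_subspace dlin c.
apply: smul_min; [exact: (subspace0 sl)|by move=> u v; apply: (subspaceD sl)|].
move=> r u /maxidealP[_ r0] _; exact: (@low_mulz F c c_gt0 0 r u).
Qed.

Lemma diamond_submodule M : submodule A M -> submodule A (diamond A M).
Proof.
move=> [M0 MD MZ]; split=> [r _|u v Mu Mv r mr|r v Ar Mv s ms].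
- by rewrite scaler0.
- by rewrite scalerDr; apply: MD; [apply: Mu|apply: Mv].
by rewrite scalerA mulrC; apply: Mv; apply: maxidealM.
Qed.

Lemma diamond_sub M : submodule A M -> M `<=` diamond A M.
Proof. by move=> [_ _ MZ] v Mv r [Ar _]; apply: MZ. Qed.

(** The scalar part of r preserves every subspace, and the part in m sends the
diamond into M. *)
Lemma submodule_between M W : submodule A M -> subspace W -> M `<=` W ->
  W `<=` diamond A M -> submodule A W.
Proof.
move=> [M0 MD MZ] sW MW Wd; split=> [|u v|r v Ar Wv]; first exact: subspace0 sW.
  exact: subspaceD sW.
rewrite -[r](subrK (r 0%N)%:A) scalerDl; apply: (subspaceD sW).
  by apply: MW; apply: Wd => //; apply: maxideal_dec.
exact: (subspaceZ (r 0%N) sW Wv).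
Qed.

(** If z^n O is contained in A, then z^(n+1) O is contained in m.  Therefore
z^(n+1) [Omega] = z^(n+1) O M lies in m M.  The bound depends on A only. *)
Lemma conductor_exists : exists n, forall M, standard A M ->
  low digit n `<=` smul (maxideal A) M.
Proof.
have [_ [n hn]] := hA; exists (n.+1 * c)%N => M [sM OM] v /low_zpow[w ->].
have : smul setT M w by rewrite OM.
move=> [m [r [u [_ Mu ->]]]]; rewrite scaler_sumr.
elim/big_ind: _ => [||k _]; [exact: smul0|by move=> *; apply: smulD|].
rewrite scalerA; apply: smul_mem => //; split.
  by rewrite exprSr -mulrA; apply: hn.
by exists (fpsz ^+ n * r k); rewrite exprS mulrA.
Qed.

Lemma standard_low n M : standard A M -> low digit n `<=` smul (maxideal A) M ->
  low digit n `<=` M.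
Proof. by move=> [sM _] h v /h; apply: smul_maxideal_sub. Qed.

(** M + z [Omega] = [Omega]; by Nakayama this characterises standard modules. *)
Definition generates_mod_z M := forall v, exists2 m, M m & low digit c (v - m).

Lemma standard_mod_z M : standard A M -> generates_mod_z M.
Proof.
move=> [sM OM] v; have : smul setT M v by rewrite OM.
have sl := low_subspace dlin c.
have sM' := submodule_subspace sM; move: v; apply: smul_min.
- by exists 0; rewrite ?subr0; [exact: subspace0 sM'|exact: subspace0 sl].
- move=> u v [m Mm lm] [m' Mm' lm']; exists (m + m'); first exact: subspaceD sM' Mm Mm'.
  by rewrite opprD addrACA; apply: subspaceD sl lm lm'.
move=> r u _ Mu; exists ((r 0%N)%:A *: u); first exact: (subspaceZ (r 0%N) sM' Mu).
rewrite -scalerBl; apply: (@low_mulz F c c_gt0 0 _ u) => //.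
by rewrite fps_coefB coef_alg0 subrr.
Qed.

(** Nakayama without inverting a matrix: iterating M + z [Omega] = [Omega] gives
O M + z^k [Omega] = [Omega] for all k, and z^k [Omega] lies in M for large k. *)
Lemma mod_z_standard n M : submodule A M -> low digit n `<=` M ->
  generates_mod_z M -> standard A M.
Proof.
move=> sM nM hM; split=> //; apply/seteqP; split=> // v _.
have smul1 u : M u -> smul setT M u by rewrite -{2}[u]scale1r; apply: smul_mem.
have step (k : nat) : exists2 s, smul setT M s & low digit (k * c) (v - s).
  elim: k => [|k [s Ms /low_zpow[w sw]]]; first by exists 0; first exact: smul0.
  have [m Mm lm] := hM w; exists (s + fpsz ^+ k *: m).
    by apply: smulD => //; apply: smul_mem.
  by rewrite opprD addrA sw -scalerBr mulSn; apply: low_zpow_mul.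
have [s Ms ls] := step n; rewrite -(subrK s v); apply: smulD => //; apply: smul1.
by apply: nM; apply: low_leq ls; rewrite leq_pmulr.
Qed.

(** Lifts to M of the basis vectors eps_i form a basis of M modulo z [Omega]. *)
Lemma mod_z_codim M : subspace M -> generates_mod_z M ->
  codim M (M `&` low digit c) c.
Proof.
move=> sM hM; have sl := low_subspace dlin c.
have /choice[e he] : forall i : 'I_c, exists e, M e /\
    low digit c ((delta_mx 0 i : Omega F c) - e).
  by move=> i; have [m] := hM (delta_mx 0 i); exists m.
exists e; split=> [i|v Mv]; first by case: (he i).
have ke (i j : 'I_c) : digit (e i) j = (i == j)%:R.
  have [_ /(_ j (ltn_ord j))] := he i.
  rewrite (digitB dlin) => /eqP; rewrite subr_eq0 => /eqP <-.
  have -> : digit (delta_mx 0 i : Omega F c) j = _ := digitE c_gt0 (delta_mx 0 i) j 0.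
  by rewrite mxE eqxx /= eq_sym; case: (i == j).
have ksum (b : {ffun 'I_c -> F}) (j : 'I_c) :
    digit (v - \sum_i b i *: (e i : OmegaF F c)) j = digit v j - b j.
  rewrite (digitB dlin) digit_sum (bigD1 j) //= ke eqxx mulr1 big1 ?addr0 //.
  by move=> i ij; rewrite ke (negbTE ij) mulr0.
exists [ffun i : 'I_c => digit v i]; split.
  split; last by move=> j jc; rewrite (ksum _ (Ordinal jc)) ffunE subrr.
  apply: (subspaceB sM Mv); apply: (subspace_sum (X := M : set (OmegaF F c))) => // i.
  by apply: subspaceZ sM _; case: (he i).
move=> b [_ lb]; apply/ffunP => j; rewrite ffunE; apply/eqP.
by rewrite -subr_eq0 -ksum; apply/eqP; apply: lb.
Qed.

End Ring.
End Modules.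

(** * Standard flags as chains of subspaces *)

Section StandardFlags.
Context {F : finFieldType} {R : realType} {c : nat} (c_gt0 : (0 < c)%N).
Context (nu : 'I_c -> R).
Context (nu_first : forall i : 'I_c, val i = 0%N -> nu i = 0).
Context (nu_incr : forall i j : 'I_c, (i < j)%N -> nu i < nu j).
Context (nu_lt1 : forall i : 'I_c, nu i < 1).
Context (A : set (fps F)) (hA : unibranch A).
Implicit Types (u v w : Omega F c) (M N P : set (Omega F c)).
Local Notation digit := (@digit F c c_gt0).
Local Notation subspace := (@subspace F (OmegaF F c)).
Local Notation codim := (@codim F (OmegaF F c)).
Local Notation pos := (posval c_gt0 nu).
Local Notation chain := (@chain F (OmegaF F c) digit).
Local Notation ext := (@ext F (OmegaF F c) digit).
Let dlin := @digit_linear F c c_gt0.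
Let DM M k := @Delta_mem F R c c_gt0 nu nu_first nu_incr nu_lt1 M k.
Let DA M M' k := @Delta_add F R c c_gt0 nu nu_first nu_incr nu_lt1 M M' k.

Definition flag_step M M' (g : R) :=
  [/\ submodule A M', M `<=` M', has_qdim M' M 1, ~ Delta nu M g
    & Delta nu M' = Delta nu M `|` [set g]].

Lemma flag_step_ext M M' k :
  flag_step M M' (pos k) <-> submodule A M' /\ ext M M' k.
Proof.
split=> [[sM' MM' cM' /DM nk /DA lM']|[sM' [_ MM' cM' nk lM']]].
  by split=> //; split=> //; apply: submodule_subspace sM'.
split=> //; first by move/DM.
exact/DA.
Qed.

Lemma flag_step_pos M M' g : flag_step M M' g -> exists k, g = pos k.
Proof.
move=> [_ _ _ _ lM']; have : Delta nu M' g by rewrite lM'; right.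
by rewrite (Delta_leads c_gt0 nu_first nu_incr nu_lt1) => -[k _ <-]; exists k.
Qed.

(** The increasing list g of valuations becomes the increasing sequence of
positions that [chain] hides in its existential quantifiers. *)
Lemma flag_steps_chain k M (s : seq (set (Omega F c))) :
  (exists g : seq R, [/\ size g = size s, sorted <%R g,
     forall j, pos j \in g -> (k <= j)%N
   & forall i, (i < size s)%N -> flag_step (fnth (M, s) i) (fnth (M, s) i.+1) g`_i])
  <-> chain (submodule A) k M s.
Proof.
have plt := posval_lt c_gt0 nu_first nu_incr nu_lt1.
elim: s k M => [|M1 s IH] k M.
  by split=> // _; exists [::]; split.
split=> [[[|g0 g] [//= [sg] srt hk hs]]|[j [kj eM sM1 /IH[g [sg srt hk hs]]]]].
  have h0 : flag_step M M1 g0 := hs 0%N isT; have [j gj] := flag_step_pos h0.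
  rewrite gj in h0; have [sM1 eM1] := (flag_step_ext _ _ _).1 h0.
  exists j; split=> //; first by apply: hk; rewrite gj mem_head.
  apply/IH; exists g; split=> //; first exact: path_sorted srt.
    move=> i ig; have := order_path_min lt_trans srt.
    move=> /allP/(_ _ ig); rewrite gj ltnNge; apply: contraTN.
    by rewrite -leNgt (posval_le c_gt0 nu_first nu_incr nu_lt1).
  by move=> i is_; apply: (hs i.+1).
exists (pos j :: g); split=> /=; first by rewrite sg.
- rewrite path_min_sorted //; apply/allP => x xg; have [n ng] := nthP 0 xg.
  move=> gn; move: xg; rewrite -gn.
  have [i ->] : exists i, g`_n = pos i.
    by apply: (flag_step_pos (hs n _)); rewrite -sg.
  by move=> /hk ji; apply: plt.
- move=> i; rewrite inE => /predU1P[/(posval_inj nu_first nu_incr nu_lt1) -> //|/hk].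
  by move=> /ltnW; apply: leq_trans.
case=> [_|i is_]; last exact: hs.
exact/flag_step_ext.
Qed.

Lemma std_flagP (p : flag F c) :
  std_flag nu A p <-> standard A p.1 /\ chain (submodule A) 0 p.1 p.2.
Proof.
case: p => M s; split.
  by move=> [sM [g [sg srt hg]]]; split=> //; apply/flag_steps_chain; exists g; split.
by move=> [sM /flag_steps_chain[g [sg srt _ hg]]]; split=> //; exists g; split.
Qed.

(** Along the chain, every leading position of X at or after k is one of M.  If u
is the vector adjoined at position j and r lies in m, then r u leads after j:
so it has no component along u, lies in X, and elimination puts it in M. *)
Lemma chain_diamond n M s : submodule A M -> low digit n `<=` M ->
  chain (submodule A) 0 M s -> last M s `<=` diamond A M.
Proof.
move=> sM nM; have ssM := submodule_subspace hA sM.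
have sd := submodule_subspace hA (diamond_submodule hA sM).
suff main k X : subspace X -> M `<=` X -> X `<=` diamond A M ->
    (forall j, (k <= j)%N -> leads digit X j -> leads digit M j) ->
    chain (submodule A) k X s -> last X s `<=` diamond A M.
  by apply: main => //; apply: diamond_sub.
elim: s k X => // X1 s IH k X sX MX Xd hk /= [j [kj eX smX1]].
have [u [X1u lu X1E]] := extP sX eX; have [sX1 XX1 _ nXj lX1] := eX.
have sl i := low_subspace dlin i.
apply: (IH j.+1) => //; first by move=> v /MX /XX1.
  rewrite X1E; apply: adjoin_min => // r mr.
  have lru : low digit j.+1 (r *: u).
    have [_ r0] := (maxidealP _ _).1 mr; case: lu => lu _.
    apply: (@low_leq _ _ digit _ (j + c)); last exact: low_mulz.
    by rewrite -addn1 leq_add2l.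
  have Xru : X (r *: u).
    have : X1 (r *: u) by case: smX1 => _ _ h; apply: h => //; case: mr.
    rewrite X1E => -[a Xa]; have [a0|a0] := eqVneq a 0.
      by move: Xa; rewrite a0 scale0r subr0.
    case: nXj; exists ((r *: u : OmegaF F c) - a *: (u : OmegaF F c)) => //.
    case: lu => lu u0; split.
      apply: (subspaceB (sl j)); first exact: low_leq lru.
      exact: (subspaceZ a (sl j)).
    by rewrite (digitB dlin) (digitZ dlin) lru // sub0r oppr_eq0 mulf_neq0.
  apply: (leads_mem dlin ssM sX MX nM) lru => // i ji; apply: hk.
  by apply: leq_trans (ltnW ji).
move=> i ji; rewrite lX1 => -[Xi|ij]; last by move: ji; rewrite ij ltnn.
by apply: hk => //; apply: leq_trans (ltnW ji).
Qed.

(** The members of such a chain lie between M and the diamond of M, where being a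
module is automatic. *)
Lemma chain_between M P k X s : submodule A M -> subspace P ->
  P `<=` diamond A M -> M `<=` X ->
  (chain (submodule A) k X s /\ last X s `<=` P) <->
  X `<=` P /\ chain (fun Y => Y `<=` P) k X s.
Proof.
move=> sM sP Pd; elim: s k X => [|X1 s IH] k X MX /=.
  by split=> [[]|[]].
split.
  move=> [[j [kj eX smX1 cs]] lP]; have [sX1 XX1 _ _ _] := eX.
  have MX1 : M `<=` X1 by move=> v /MX /XX1.
  have [X1P cs'] := (IH j.+1 X1 MX1).1 (conj cs lP).
  by split; [move=> v /XX1 /X1P|exists j].
move=> [XP [j [kj eX X1P cs]]]; have [sX1 XX1 _ _ _] := eX.
have MX1 : M `<=` X1 by move=> v /MX /XX1.
have [cs' lP] := (IH j.+1 X1 MX1).2 (conj X1P cs).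
split=> //; exists j; split=> //; apply: (submodule_between hA sM) => //.
by move=> v /X1P /Pd.
Qed.

End StandardFlags.

(** * Sums over standard flags *)

Section Sums.
Context {F : finFieldType} {R : realType} {c : nat} (c_gt0 : (0 < c)%N).
Context (nu : 'I_c -> R).
Context (nu_first : forall i : 'I_c, val i = 0%N -> nu i = 0).
Context (nu_incr : forall i j : 'I_c, (i < j)%N -> nu i < nu j).
Context (nu_lt1 : forall i : 'I_c, nu i < 1).
Context (A : set (fps F)) (hA : unibranch A).
Implicit Types (u v w : Omega F c) (M N P : set (Omega F c)).
Local Notation digit := (@digit F c c_gt0).
Local Notation subspace := (@subspace F (OmegaF F c)).
Local Notation codim := (@codim F (OmegaF F c)).
Let dlin := @digit_linear F c c_gt0.

Lemma qdimE M N d : subspace M -> subspace N -> codim N M d -> qdim N M = d.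
Proof.
by move=> sM sN h; apply: xget_unique => // d' h'; apply: codim_inj sM sN h' h.
Qed.

Lemma subspaceT : subspace setT. Proof. by []. Qed.

Lemma enum_fsum (I : choiceType) (E : nmodType) (S : set I) L (f : I -> E) :
  enumerates S L -> finite_set S /\ \sum_(x \in S) f x = \sum_(x <- L) f x.
Proof.
move=> [uL hL]; have -> : S = [set` L].
  by apply/seteqP; split=> x /hL.
by split; [exact: finite_seq|rewrite -fsbig_seq].
Qed.

Lemma t_frac_neq0 : t_frac != 0.
Proof. by rewrite tofrac_eq0 polyX_eq0. Qed.

Definition weight (p : flag F c) : Zat := t_poly ^+ deg (ftop p) * a_poly ^+ flen p.

(** Each step of a flag lowers the degree by one: this is where a / t comes from. *)
Lemma tofrac_weight (p : flag F c) d : deg (ftop p) = d ->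
  tofrac (weight p) = t_frac ^+ (d + flen p) * (a_frac / t_frac) ^+ flen p.
Proof.
move=> <-; rewrite /weight tofracM !tofracXn exprD expr_div_n.
by rewrite -mulrA [t_frac ^+ flen p * _]mulrC divfK // expf_neq0 // t_frac_neq0.
Qed.

(** This covers both (i), where P is the diamond of M, and (ii), where P = N. *)
Lemma enum_flags_above M P d : standard A M -> subspace P -> M `<=` P ->
  P `<=` diamond A M -> codim P M d ->
  exists2 L, enumerates [set s | std_flag nu A (M, s) /\ last M s `<=` P] L
    & \sum_(s <- L) tofrac (weight (M, s)) = t_frac ^+ deg M * qfactor #|F| d.
Proof.
move=> stM sP MP Pd hd; have [n hn] := conductor_exists c_gt0 hA.
have [sM _] := stM; have nM := standard_low stM (hn M stM).
have ssM := submodule_subspace hA sM.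
have hd0 : codim (tail digit M P 0) M d by rewrite tail0.
have [L [uL hL] sL] := enum_chain dlin (a_frac / t_frac) sP ssM MP nM hd0.
have hLs s : std_flag nu A (M, s) /\ last M s `<=` P <-> s \in L.
  have CB := chain_between c_gt0 hA 0 s sM sP Pd (fun v (h : M v) => h).
  have SP := std_flagP c_gt0 nu_first nu_incr nu_lt1 hA (M, s).
  split=> [[/SP[_ h1] h2]|/hL h]; first by apply/hL; case: (CB.1 (conj h1 h2)).
  by have [h1 h2] := CB.2 (conj MP h); split=> //; apply/SP.
exists L => //.
rewrite /qfactor -sL mulr_sumr; apply: eq_big_seq => s /hL cs.
have [sl Ml lP cl] := chain_last ssM MP cs.
have nl : low digit n `<=` last M s by move=> v /nM /Ml.
have [e he] := codim_exists dlin sl subspaceT (fun v _ => I) nl.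
have he' := codim_add ssM sl subspaceT Ml (fun v _ => I) he cl.
rewrite (@tofrac_weight _ e); last exact: qdimE.
by rewrite /deg (qdimE ssM subspaceT he').
Qed.

(** The standard flags are grouped by their bottom M, and the allowed tops P may
depend on M. *)
Lemma flag_sum (Ms : seq (set (Omega F c))) (P : set (Omega F c) -> set (Omega F c))
    (d : set (Omega F c) -> nat) (S : set (flag F c)) :
  uniq Ms ->
  (forall M, M \in Ms -> [/\ standard A M, subspace (P M), M `<=` P M,
      P M `<=` diamond A M & codim (P M) M (d M)]) ->
  (forall p, S p <-> [/\ std_flag nu A p, fbot p \in Ms & ftop p `<=` P (fbot p)]) ->
  finite_set S /\ tofrac (contribution S) =
    \sum_(M <- Ms) t_frac ^+ deg M * qfactor #|F| (d M).
Proof.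
move=> uMs hMs hS.
have /choice[g gP] : forall M, exists L, M \in Ms ->
    enumerates [set s | std_flag nu A (M, s) /\ last M s `<=` P M] L /\
    \sum_(s <- L) tofrac (weight (M, s)) = t_frac ^+ deg M * qfactor #|F| (d M).
  move=> M; have [/hMs[h1 h2 h3 h4 h5]|] := boolP (M \in Ms); last by exists [::].
  by have [L] := enum_flags_above h1 h2 h3 h4 h5; exists L.
have eS : enumerates S [seq (M, s) | M <- Ms, s <- g M].
  split.
    apply: allpairs_uniq_dep => //; first by move=> M hM; have [[]] := gP M hM.
    by move=> [M1 s1] [M2 s2] _ _ /= [-> ->].
  move=> [M s]; split=> [/hS[h1 h2 h3]|/allpairsPdep[M' [s' [hM hs [-> ->]]]]].
    apply/allpairsPdep; exists M, s; split=> //.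
    by have [[_ hg] _] := gP M h2; apply/hg.
  by have [[_ hg] _] := gP M' hM; have [h1 h2] := (hg _).2 hs; apply/hS.
have [fS sS] := enum_fsum weight eS; split=> //.
rewrite /contribution sS big_allpairs_dep rmorph_sum; apply: eq_big_seq => M hM.
by rewrite rmorph_sum; have [_ <-] := gP M hM.
Qed.

(** Such a subspace is determined by the set of its truncations to n digits. *)
Lemma finite_subspaces_above n : finite_set [set M | subspace M /\ low digit n `<=` M].
Proof.
pose tr v : {ffun 'I_n -> F} := [ffun i : 'I_n => digit v i].
apply: (@sub_finite_set _ _ ((fun B : {set {ffun 'I_n -> F}} =>
    [set v | tr v \in B]) @` setT)); last first.
  by apply: finite_image; apply: finite_finset.
move=> M [sM nM].
exists [set b : {ffun 'I_n -> F} | `[< exists2 v, M v & tr v = b >]]%SET => //.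
apply/seteqP; split=> v /=; rewrite inE.
  move=> /asboolP[u Mu uv]; rewrite -(subrK u v); apply: (subspaceD sM) => //; apply: nM.
  move=> j jn; rewrite (digitB dlin).
  by have /ffunP/(_ (Ordinal jn)) := uv; rewrite !ffunE /= => ->; rewrite subrr.
by move=> Mv; apply/asboolP; exists v.
Qed.

Lemma transverse_count_gt q e r d : (r < d)%N -> transverse_count q e r d = 0%N.
Proof.
elim: r d => [|r IH] [|d] //= rd; rewrite !IH //; last exact: ltnW.
by rewrite muln0.
Qed.

End Sums.

(** * Gaussian binomials *)

Section Gauss.
Context (q : nat).
Context (q_gt1 : (1 < q)%N).

Lemma tofrac_natr (k : nat) : tofrac (k%:R : Zat) = k%:R :> Qat.
Proof. by rewrite rmorph_nat. Qed.

Lemma Qat_natr_inj (m n : nat) : (m%:R == n%:R :> Qat) = (m == n).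
Proof.
rewrite -!tofrac_natr tofrac_eq -!polyC_natr.
by rewrite !(inj_eq (@polyC_inj _)) eqr_nat.
Qed.

Lemma qpow_sub1_neq0 i : (q%:R ^+ i.+1 - 1 : Qat) != 0.
Proof.
rewrite subr_eq0 -natrX (Qat_natr_inj _ 1) gtn_eqF //.
by rewrite -{1}(expn0 q) ltn_exp2l.
Qed.

Lemma gauss_binomSr r d :
  gauss_binom q r d.+1 = gauss_binom q r d * ((q%:R ^+ (r - d) - 1) / (q%:R ^+ d.+1 - 1)).
Proof. by rewrite /gauss_binom big_ord_recr. Qed.

Lemma gauss_binom_gt r d : (r < d)%N -> gauss_binom q r d = 0.
Proof.
move=> rd; rewrite /gauss_binom (bigD1 (Ordinal rd)) //= subnn expr0 subrr.
by rewrite !mul0r.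
Qed.

Lemma gauss_binomSS r d :
  gauss_binom q r.+1 d.+1 =
  gauss_binom q r d * ((q%:R ^+ r.+1 - 1) / (q%:R ^+ d.+1 - 1)).
Proof.
rewrite /gauss_binom !prodf_div mulf_div; congr (_ / _); last by rewrite big_ord_recr.
by rewrite big_ord_recl subn0 mulrC; congr (_ * _); apply: eq_bigr => i _; rewrite subSS.
Qed.

(** For d > r both sides vanish; this uses that the factor i = r of the product is
zero. *)
Lemma gauss_pascal r d :
  gauss_binom q r.+1 d.+1 =
  gauss_binom q r d.+1 + q%:R ^+ (r - d) * gauss_binom q r d.
Proof.
have [dr|rd] := leqP d r; last first.
  rewrite !gauss_binom_gt ?mulr0 ?addr0 //; exact: ltnW.
rewrite gauss_binomSS gauss_binomSr [q%:R ^+ (r - d) * _]mulrC -mulrDr.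
congr (_ * _); apply: (mulIf (qpow_sub1_neq0 d)).
rewrite divfK ?qpow_sub1_neq0 // mulrDl divfK ?qpow_sub1_neq0 //.
by rewrite mulrBr mulr1 -exprD addnS subnK // [RHS]addrC subrKA.
Qed.

(** The recursion for the counts is q^(cd) times the q-Pascal rule, as
c + r - d + c d = c (d + 1) + (r - d). *)
Lemma transverse_countE e r d :
  (transverse_count q e r d)%:R = q%:R ^+ (e * d) * gauss_binom q r d :> Qat.
Proof.
elim: r d => [|r IH] [|d] /=.
- by rewrite muln0 expr0 mul1r /gauss_binom big_ord0.
- by rewrite gauss_binom_gt ?mulr0.
- by rewrite IH muln0 /gauss_binom !big_ord0.
rewrite natrD natrM natrX !IH gauss_pascal mulrDr; congr (_ + _).
have [dr|rd] := leqP d r; last by rewrite gauss_binom_gt ?mulr0.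
by rewrite mulrA -exprD mulrA -exprD; congr (_ ^+ _ * _); rewrite mulnS -addnBA // addnAC.
Qed.
End Gauss.

(** * The contributions of flags over a unibranch ring *)

Section Contributions.
Context {F : finFieldType} {R : realType} {c : nat} (c_gt0 : (0 < c)%N).
Context (nu : 'I_c -> R).
Context (nu_first : forall i : 'I_c, val i = 0%N -> nu i = 0).
Context (nu_incr : forall i j : 'I_c, (i < j)%N -> nu i < nu j).
Context (nu_lt1 : forall i : 'I_c, nu i < 1).
Context (A : set (fps F)) (hA : unibranch A).
Implicit Types (u v w : Omega F c) (M N P : set (Omega F c)).
Local Notation digit := (@digit F c c_gt0).
Local Notation subspace := (@subspace F (OmegaF F c)).
Local Notation codim := (@codim F (OmegaF F c)).
Local Notation q := #|F|.
Local Notation transverse := (@transverse F (OmegaF F c)).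
Let dlin := @digit_linear F c c_gt0.
Let flagP := @std_flagP F R c c_gt0 nu nu_first nu_incr nu_lt1 A hA.
Let sumP := @flag_sum F R c c_gt0 nu nu_first nu_incr nu_lt1 A hA.

Lemma codim_standard M P : standard A M -> subspace P -> M `<=` P ->
  exists d, codim P M d.
Proof.
move=> stM sP MP; have [n hn] := conductor_exists c_gt0 hA; have [sM _] := stM.
apply: (codim_exists dlin (submodule_subspace hA sM) sP MP).
exact: standard_low stM (hn M stM).
Qed.

Lemma codim_qdim M P d : subspace M -> subspace P -> codim P M d ->
  codim P M (qdim P M).
Proof. by move=> sM sP h; rewrite (qdimE sM sP h). Qed.

Lemma diamond_subspace M : submodule A M -> subspace (diamond A M).
Proof. by move=> sM; apply: (submodule_subspace hA); apply: diamond_submodule. Qed.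

Lemma codim_diamond M : standard A M -> codim (diamond A M) M (ddiamond A M).
Proof.
move=> stM; have [sM _] := stM; have sd := diamond_subspace sM.
have [d hd] := codim_standard stM sd (diamond_sub sM).
exact: codim_qdim (submodule_subspace hA sM) sd hd.
Qed.

Lemma codim_deg M : standard A M -> codim setT M (deg M).
Proof.
move=> stM; have [d hd] := codim_standard stM subspaceT (fun v _ => I).
by apply: codim_qdim hd => //; case: stM => sM _; apply: submodule_subspace sM.
Qed.

(** N / m N is an extension of N / (N meet z [Omega]), of dimension c, by
(N meet z [Omega]) / m N: this is the K of (ii). *)
Lemma codim_mod_maxideal N : standard A N ->
  exists2 r, codim (N `&` low digit c) (smul (maxideal A) N) r & rkq A N = (c + r)%N.
Proof.
move=> stN; have [sN _] := stN; have ssN := submodule_subspace hA sN.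
have [n hn] := conductor_exists c_gt0 hA.
have sX := smul_maxideal_subspace hA N.
have sl := low_subspace dlin c.
have sK : subspace (N `&` low digit c) := subspaceI ssN sl.
have XK : smul (maxideal A) N `<=` N `&` low digit c.
  by move=> v hv; split; [exact: smul_maxideal_sub hv|exact: smul_maxideal_low hv].
have [r hr] := codim_exists dlin sX sK XK (hn N stN).
exists r => //; apply: (qdimE sX ssN).
have cK := mod_z_codim ssN (standard_mod_z c_gt0 hA stN).
by apply: codim_add hr => //; move=> v [].
Qed.

Lemma codim_rkq N : standard A N -> codim N (smul (maxideal A) N) (rkq A N).
Proof.
move=> stN; have [sN _] := stN; have ssN := submodule_subspace hA sN.
have [n hn] := conductor_exists c_gt0 hA.
have sX := smul_maxideal_subspace hA N.
have [d hd] := codim_exists dlin sX ssN (smul_maxideal_sub sN) (hn N stN).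
exact: codim_qdim hd.
Qed.

Lemma rkq_ge N : standard A N -> (c <= rkq A N)%N.
Proof. by move=> /codim_mod_maxideal[r _ ->]; rewrite leq_addr. Qed.

Lemma diamond_full M : smul (maxideal A) setT `<=` M -> diamond A M = setT.
Proof. by move=> h; apply/seteqP; split=> // v _ r mr; apply/h/smul_mem. Qed.

(** Multiplication by m maps each step of the filtration into the next smaller
one.  So if M is its own diamond and contains a step, it also contains the next
larger one; one climbs from the conductor to [Omega]. *)
Lemma diamond_eq M : standard A M -> (diamond A M = M <-> M = setT).
Proof.
move=> stM; split=> [dM|->]; last by apply: diamond_full.
have [n hn] := conductor_exists c_gt0 hA; have nM := standard_low stM (hn M stM).
suff low0 k : low digit (n - k) `<=` M.
  by apply/seteqP; split=> // v _; apply: (low0 n); rewrite subnn.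
elim: k => [|k IH]; first by rewrite subn0.
move=> v lv; rewrite -dM => r mr; apply: IH.
have [_ r0] := (maxidealP _ _).1 mr.
apply: (low_leq _ (low_mulz r0 lv)); apply: (@leq_trans (n - k.+1).+1).
  by rewrite subnS leqSpred.
by rewrite -addn1 leq_add2l.
Qed.

Lemma std_flag_sub_top (p : flag F c) : std_flag nu A p ->
  [/\ standard A (fbot p), fbot p `<=` ftop p & ftop p `<=` diamond A (fbot p)].
Proof.
move=> /flagP[stM ch]; split=> //; last first.
  have [n hn] := conductor_exists c_gt0 hA; have [sM _] := stM.
  exact: (chain_diamond hA sM (standard_low stM (hn _ stM)) ch).
case: p {stM} ch => M s; rewrite /fbot /ftop /=.
elim: s M {1}0%N => [M k _ v //|X1 s IH M k /=].
by case=> j [_ [_ MX1 _ _ _] _ /IH h] v /MX1 /h.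
Qed.

Lemma contribution_fiber M : standard A M ->
  tofrac (contribution (std_flag nu A `&` [set p | fbot p = M])) =
  t_frac ^+ deg M * qfactor q (ddiamond A M).
Proof.
move=> stM; have [sM _] := stM.
have hMs M' : M' \in [:: M] -> [/\ standard A M', subspace (diamond A M'),
    M' `<=` diamond A M', diamond A M' `<=` diamond A M'
  & codim (diamond A M') M' (ddiamond A M')].
  rewrite inE => /eqP ->; split=> //; [exact: diamond_subspace| |exact: codim_diamond].
  exact: diamond_sub.
have hS p : (std_flag nu A `&` [set p | fbot p = M]) p <->
    [/\ std_flag nu A p, fbot p \in [:: M] & ftop p `<=` diamond A (fbot p)].
  rewrite inE; split=> [[h pM]|[h /eqP]]; last by split.
  by have [_ _ hd] := std_flag_sub_top h; split=> //; apply/eqP.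
by have [_ ->] := sumP (erefl : uniq [:: M]) hMs hS; rewrite big_seq1.
Qed.

Lemma enum_standard : exists L, enumerates (standard A (c := c)) L.
Proof.
have [n hn] := conductor_exists c_gt0 hA.
have /finite_seqP[L LE] : finite_set (standard A (c := c)).
  apply: sub_finite_set (finite_subspaces_above c_gt0 n) => M stM; split.
    by apply: (submodule_subspace hA); case: stM.
  exact: standard_low stM (hn M stM).
exists (undup L); split=> [|M]; first exact: undup_uniq.
by rewrite mem_undup LE.
Qed.

Lemma Hmot_sum : finite_set (std_flag nu A) /\
  tofrac (Hmot nu A) = \sum_(M \in [set M : set (Omega F c) | standard A M])
    t_frac ^+ deg M * qfactor q (ddiamond A M).
Proof.
have [L eL] := enum_standard; have [uL hL] := eL.
have hMs M : M \in L -> [/\ standard A M, subspace (diamond A M),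
    M `<=` diamond A M, diamond A M `<=` diamond A M
  & codim (diamond A M) M (ddiamond A M)].
  move=> /hL stM; have [sM _] := stM.
  split=> //; [exact: diamond_subspace| |exact: codim_diamond].
  exact: diamond_sub.
have hS p : std_flag nu A p <->
    [/\ std_flag nu A p, fbot p \in L & ftop p `<=` diamond A (fbot p)].
  split=> [h|[]//]; have [st _ hd] := std_flag_sub_top h.
  by split=> //; apply/hL.
have [fS ->] := sumP uL hMs hS; split=> //.
by have [_ ->] := enum_fsum (fun M => t_frac ^+ deg M * qfactor q (ddiamond A M)) eL.
Qed.

Section Between.
Context (N : set (Omega F c)) (stN : standard A N).
Local Notation mN := (smul (maxideal A) N).
Local Notation K := (N `&` low digit c).

Let ssN : subspace N.
Proof. by case: stN => sN _; apply: submodule_subspace sN. Qed.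

(** Standard means M + z [Omega] = [Omega]; intersected with N, which is itself
standard, this is M + K = N. *)
Lemma transverse_standard M d : transverse mN K N d M <->
  [/\ standard A M, mN `<=` M, M `<=` N & codim N M d].
Proof.
have sl := low_subspace dlin c; have [sN _] := stN.
split=> [[sM XM MN cM tM]|[stM XM MN cM]].
  split=> //; have [n hn] := conductor_exists c_gt0 hA.
  apply: (@mod_z_standard F c c_gt0 A n) => //.
  - apply: (@submodule_between F c A hA mN M _ sM XM).
      split; [exact: smul0|exact: smulD|move=> r v Ar].
      by apply: smulZ => s; apply: maxidealM.
    by move=> v /MN Nv r mr; apply: smul_mem.
  - by move=> v /(hn N stN)/XM.
  move=> v; have [u Nu lu] := standard_mod_z c_gt0 hA stN v.
  have [m Mm [_ lm]] := tM u Nu; exists m => //.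
  exact: subspace_trans sl lu lm.
split=> //; first by apply: (submodule_subspace hA); case: stM.
move=> v Nv; have [m Mm lm] := standard_mod_z c_gt0 hA stM v.
by exists m => //; split=> //; apply: (subspaceB ssN Nv); apply: MN.
Qed.

Lemma deg_between M d : standard A M -> M `<=` N -> codim N M d ->
  deg M = (deg N + d)%N.
Proof.
move=> stM MN cM; have ssM : subspace M.
  by apply: (submodule_subspace hA); case: stM.
apply: (qdimE ssM subspaceT).
exact: codim_add ssM ssN subspaceT MN (fun v _ => I) (codim_deg stN) cM.
Qed.

Let S := std_flag nu A `&` [set p | mN `<=` fbot p /\ ftop p `<=` N].
Let r := (rkq A N - c)%N.

Lemma enum_between d : exists2 L,
  enumerates [set M | [/\ standard A M, mN `<=` M, M `<=` N & codim N M d]] L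
  & size L = transverse_count q c r d.
Proof.
have [n hn] := conductor_exists c_gt0 hA; have sl := low_subspace dlin c.
have [r' hr' rE] := codim_mod_maxideal stN.
have sK : subspace K := subspaceI ssN sl.
have sX := smul_maxideal_subspace hA N; have [sN _] := stN.
have XK : mN `<=` K.
  by move=> v hv; split; [exact: smul_maxideal_sub hv|exact: smul_maxideal_low hv].
have cK := mod_z_codim ssN (standard_mod_z c_gt0 hA stN).
have KN : K `<=` N by move=> v [].
have := enum_transverse dlin d sX sK ssN (hn N stN) XK KN cK hr'.
move=> [L [uL hL] sL]; exists L; last by rewrite /r rE addKn.
by split=> // M; split=> [/transverse_standard/hL|/hL/transverse_standard].
Qed.

Lemma sum_between (L : seq (set (Omega F c))) (d : set (Omega F c) -> nat)
    (S' : set (flag F c)) :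
  uniq L ->
  (forall M, M \in L -> [/\ standard A M, mN `<=` M, M `<=` N & codim N M (d M)]) ->
  (forall p, S' p <-> S p /\ fbot p \in L) ->
  tofrac (contribution S') =
  \sum_(M <- L) t_frac ^+ (deg N + d M) * qfactor q (d M).
Proof.
move=> uL hL hS'.
have hMs M : M \in L -> [/\ standard A M, subspace N, M `<=` N,
    N `<=` diamond A M & codim N M (d M)].
  move=> /hL[stM XM MN cM]; split=> //.
  by move=> v Nv s ms; apply: XM; apply: smul_mem.
have hS p : S' p <-> [/\ std_flag nu A p, fbot p \in L & ftop p `<=` N].
  split=> [/hS'[[h1 [_ h2]] h3]|[h1 h2 h3]]; first by split.
  by apply/hS'; split=> //; split=> //; split=> //; have [] := hL _ h2.
have [_ ->] := sumP uL hMs hS; apply: eq_big_seq => M /hL[stM _ MN cM].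
by rewrite (deg_between stM MN cM).
Qed.

Let term d := t_frac ^+ (deg N + d) * q%:R ^+ (c * d)
  * gauss_binom q r d * qfactor q d.

Lemma sum_const_between d (L : seq (set (Omega F c))) :
  size L = transverse_count q c r d ->
  \sum_(M <- L) t_frac ^+ (deg N + d) * qfactor q d = term d.
Proof.
move=> sL; rewrite big_const_seq count_predT sL iter_addr_0 -mulr_natl.
rewrite (transverse_countE (card_finNzRing_gt1 F)) /term.
by rewrite mulrA; congr (_ * _); rewrite mulrC mulrA.
Qed.

Lemma between_codim p : S p -> exists2 d, codim N (fbot p) d
  & [/\ standard A (fbot p), mN `<=` fbot p & fbot p `<=` N].
Proof.
move=> [h [h1 h2]]; have [st bt _] := std_flag_sub_top h.
have bN : fbot p `<=` N by move=> v /bt /h2.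
by have [d hd] := codim_standard st ssN bN; exists d.
Qed.

Lemma contribution_between_codim d :
  tofrac (contribution (S `&` [set p | has_qdim N (fbot p) d])) = term d.
Proof.
have [L [uL hL] sL] := enum_between d.
rewrite (@sum_between L (fun=> d)) ?sum_const_between //; first by move=> M /hL.
move=> p; split=> [[Sp cp]|[Sp /hL[_ _ _ cp]]]; last by split.
by split=> //; apply/hL; have [_ _ []] := between_codim Sp.
Qed.

(** The flags are split by the codimension d of their bottom in N; no bottom has
codimension d > r, since then the count is zero. *)
Lemma contribution_between :
  tofrac (contribution S) = \sum_(0 <= d < r.+1) term d.
Proof.
have /choice[L hL] : forall d, exists L,
    enumerates [set M | [/\ standard A M, mN `<=` M, M `<=` N & codim N M d]] L
    /\ size L = transverse_count q c r d.
  by move=> d; have [L] := enum_between d; exists L.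
have LP d M : M \in L d <-> [/\ standard A M, mN `<=` M, M `<=` N & codim N M d].
  by have [[_ h] _] := hL d; split=> /h.
have Lq d M : M \in L d -> qdim N M = d.
  move=> /LP[stM _ _ cM]; apply: qdimE cM => //.
  by apply: (submodule_subspace hA); case: stM.
rewrite (@sum_between [seq M | d <- index_iota 0 r.+1, M <- L d] (fun M => qdim N M)).
- rewrite big_allpairs_dep; apply: eq_bigr => d _; have [_ sL] := hL d.
  by rewrite -(sum_const_between sL); apply: eq_big_seq => M /Lq ->.
- apply: allpairs_uniq_dep; [exact: iota_uniq|by move=> d _; have [[]] := hL d|].
  move=> [d1 M1] [d2 M2] /allpairsPdep[x1 [y1 [_ h1 [-> ->]]]].
  move=> /allpairsPdep[x2 [y2 [_ h2 [-> ->]]]] /= E; rewrite E in h1 *.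
  by rewrite -(Lq _ _ h1) -(Lq _ _ h2).
- by move=> M /allpairsPdep[d [M' [_ h ->]]]; rewrite (Lq _ _ h); apply/LP.
move=> p; split=> [Sp|[]//]; split=> //.
have [d cd [h1 h2 h3]] := between_codim Sp.
have hd : fbot p \in L d by apply/LP.
apply/allpairsPdep; exists d, (fbot p); split=> //.
rewrite mem_index_iota /= ltnS leqNgt; apply/negP => rd.
have [_] := hL d; rewrite transverse_count_gt // => /size0nil E.
by rewrite E in hd.
Qed.

End Between.
End Contributions.

(** * The cusp *)

Section Cusp.
Context {F : finFieldType} {c : nat} (c_gt0 : (0 < c)%N).
Implicit Types (M : set (Omega F c)).
Local Notation A := (cusp_ring (F := F)).
Local Notation digit := (@digit F c c_gt0).
Local Notation codim := (@codim F (OmegaF F c)).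
Let dlin := @digit_linear F c c_gt0.

(** The numbers 2 i + 3 j are all natural numbers except 1; conversely a series
without term of degree 1 is recovered from exponents with j = 0 or j = 1. *)
Lemma cusp_ringP (f : fps F) : A f <-> f 1%N = 0.
Proof.
split=> [[a ->]|f1].
  by rewrite big1 // => i _; rewrite big1 // => j; case: i => [[|[|i]]] //=;
     case: j => [[|[|j]]].
exists (fun i j => if (j < 2)%N then f (2 * i + 3 * j)%N else 0) => n.
(* the exponents of the monomial x^i0 y^j0 that carries the coefficient of z^n *)
pose j0 := odd n : nat; pose i0 := ((n - 3 * j0) %/ 2)%N.
have j0n : (j0 < n.+1)%N by rewrite /j0; case: n {i0 j0} => //= n; case: odd.
have [n1|n1] := eqVneq n 1%N.
  rewrite n1 f1 big1 // => i _; rewrite big1 // => j; case: i => [[|[|i]]] //=;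
     case: j => [[|[|j]]] //.
have ij0 : (2 * i0 + 3 * j0 = n)%N.
  have n3 : (3 * j0 <= n)%N.
    by rewrite /j0; case: n n1 {i0 j0 j0n} => [|[|[|n]]] //= _; case: odd.
  have ev : odd (n - 3 * j0) = false by rewrite oddB // oddM /= /j0 oddb addbb.
  by rewrite mulnC divnK ?subnK // dvdn2 ev.
have i0n : (i0 < n.+1)%N by rewrite ltnS; apply: leq_trans (leq_div _ _) (leq_subr _ _).
rewrite (bigD1 (Ordinal i0n)) //= (bigD1 (Ordinal j0n)) /=; last by rewrite ij0.
have -> : (j0 < 2)%N by rewrite /j0; case: odd.
rewrite ij0 big1 ?addr0 => [|j /andP[/eqP E jj0]]; last first.
  case: ltnP => // j2; exfalso; move/negP: jj0; apply; apply/eqP/val_inj => /=.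
  have /(congr1 odd) := E; rewrite oddD !oddM /= /j0 => <-.
  by move: j2; case: (nat_of_ord j) => [|[|]].
rewrite big1 ?addr0 // => i ii0; rewrite big1 // => j /eqP E.
case: ltnP => // j2; exfalso; move/negP: ii0; apply; apply/eqP/val_inj => /=.
have jE : j = j0 :> nat.
  have /(congr1 odd) := E; rewrite oddD !oddM /= /j0 => <-.
  by move: j2; case: (nat_of_ord j) => [|[|]].
by apply/eqP; rewrite -(eqn_pmul2l (isT : 0 < 2)%N) -(eqn_add2r (3 * j0)) ij0 -{2}E jE.
Qed.

Lemma coef_mul1 (f g : fps F) : (f * g) 1%N = f 0%N * g 1%N + f 1%N * g 0%N.
Proof. by rewrite /GRing.mul /= !big_ord_recl big_ord0 addr0. Qed.

Lemma cusp_unibranch : unibranch A.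
Proof.
have memA x : x \in [in A] <-> x 1%N = 0.
  by split=> [/set_mem/cusp_ringP|/cusp_ringP/mem_set].
split; last by exists 2 => f; apply/cusp_ringP; rewrite coef_fpszXM.
split=> [|a f g /memA f1 /memA g1|f g /memA f1 /memA g1]; apply/memA => //.
  by rewrite -mulr_algl -[LHS]/((a%:A * f) 1%N + g 1%N) coef_algM f1 g1 mulr0 addr0.
by rewrite coef_mul1 f1 g1 mulr0 mul0r addr0.
Qed.

Lemma cusp_maxideal_low r (v : Omega F c) : maxideal A r -> low digit (2 * c) (r *: v).
Proof.
move=> [/cusp_ringP + [g rg]]; rewrite rg coef_fpszM => g0.
rewrite -scalerA mul2n -addnn; apply: low_mulz => //.
exact: (@low_mulz F c c_gt0 0 g v).
Qed.

Lemma cusp_smul : smul (maxideal A) setT = low digit (2 * c).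
Proof.
have sl := low_subspace dlin (2 * c).
apply/seteqP; split.
  apply: smul_min; [exact: (subspace0 sl)|by move=> u v; apply: (subspaceD sl)|].
  by move=> r u mr _; apply: cusp_maxideal_low.
move=> v /low_zpow[w ->]; apply: smul_mem => //; split.
  by apply/cusp_ringP; rewrite -[fpsz ^+ 2]mulr1 coef_fpszXM.
by exists fpsz; rewrite expr2.
Qed.

Lemma cusp_standard_low M : standard A M -> low digit (2 * c) `<=` M.
Proof.
move=> [[M0 MD MZ] OM] v /low_zpow[w ->].
have : smul setT M w by rewrite OM.
move=> [n [r [u [_ Mu ->]]]]; rewrite scaler_sumr; elim/big_ind: _ => // k _.
rewrite scalerA; apply: MZ => //; apply/cusp_ringP.
by rewrite coef_fpszXM.
Qed.

Lemma cusp_diamond M : standard A M -> diamond A M = setT.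
Proof.
move=> /cusp_standard_low h; apply/seteqP; split=> // v _ r mr.
exact/h/cusp_maxideal_low.
Qed.

Lemma standard_setT (B : set (fps F)) : unibranch B ->
  standard B (setT : set (Omega F c)).
Proof.
move=> hB; split=> //; apply/seteqP; split=> // v _.
by rewrite -[v]scale1r; apply: smul_mem.
Qed.

Lemma codim_low n : codim setT (low digit n) n.
Proof.
elim: n => [|n IH].
  by rewrite (_ : low digit 0 = setT); [exact: codim_refl|apply/seteqP; split].
pose e : Omega F c := \row_i Fps (fun m => (m * c + i == n)%N%:R).
have eE j : digit e j = (j == n)%:R by rewrite /digit mxE /= -divn_eq.
have le : low digit n e by move=> j jn; rewrite eE ltn_eqF.
have sl k := low_subspace dlin k.
have lS : low digit n.+1 `<=` low digit n by exact: low_leq.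
have ne : ~ low digit n.+1 e by move=> /(_ n (leqnn _)) /eqP; rewrite eE eqxx oner_eq0.
rewrite -[X in codim _ _ X]addn1.
apply: (codim_add (sl n.+1) (sl n) subspaceT lS (fun v _ => I) IH).
suff -> : low digit n = adjoin (low digit n.+1) (e : OmegaF F c) by apply: adjoin_codim.
apply/seteqP; split; last exact: adjoin_min.
move=> v lv; exists (digit v n / digit e n).
by apply: low_cancel => //; rewrite eE eqxx oner_neq0.
Qed.

End Cusp.

Theorem theorem6p3 (F : finFieldType) (R : realType) (c : nat) (c_gt0 : (0 < c)%N)
    (nu : 'I_c -> R)
    (nu_first : forall i : 'I_c, val i = 0%N -> nu i = 0)
    (nu_incr : forall i j : 'I_c, (i < j)%N -> nu i < nu j)
    (nu_lt1 : forall i : 'I_c, nu i < 1) :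
  let q := #|F| in
  (forall A : set (fps F), unibranch A ->
    [/\ (* finiteness of the sums and of the dimensions involved *)
        finite_set (std_flag nu A) /\ finite_set [set M : set (Omega F c) | standard A M],
        forall M : set (Omega F c), standard A M ->
          [/\ has_qdim setT M (deg M),
              has_qdim M (smul (maxideal A) M) (rkq A M),
              has_qdim (diamond A M) M (ddiamond A M)
            & (c <= rkq A M)%N],
        forall M : set (Omega F c), standard A M ->
          [/\ submodule A (diamond A M),
              smul (maxideal A) setT `<=` M -> diamond A M = setT
            & diamond A M = M <-> M = setT],
        (* (i) *)
        [/\ forall M : set (Omega F c), standard A M ->
              tofrac (contribution (std_flag nu A `&` [set p | fbot p = M]))
              = t_frac ^+ deg M * qfactor q (ddiamond A M),
            forall M M' : set (Omega F c), standard A M -> standard A M' ->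
              deg M = deg M' -> ddiamond A M = ddiamond A M' ->
              contribution (std_flag nu A `&` [set p | fbot p = M])
              = contribution (std_flag nu A `&` [set p | fbot p = M'])
          & tofrac (Hmot nu A)
            = \sum_(M \in [set M : set (Omega F c) | standard A M])
                t_frac ^+ deg M * qfactor q (ddiamond A M)]
      & (* (ii) *)
        forall N : set (Omega F c), standard A N ->
          let r := (rkq A N - c)%N in
          let S := std_flag nu A `&`
            [set p | smul (maxideal A) N `<=` fbot p /\ ftop p `<=` N] in
          let term d := t_frac ^+ (deg N + d) * q%:R ^+ (c * d)
            * gauss_binom q r d * qfactor q d in
          [/\ tofrac (contribution S) = \sum_(0 <= d < r.+1) term d,
              forall d, (d <= r)%N ->
                tofrac (contribution (S `&` [set p | has_qdim N (fbot p) d]))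
                = term d
            & forall p d, S p -> has_qdim N (fbot p) d ->
                deg (fbot p) = (deg N + d)%N]])
  /\ (* (iii) *)
  (let A := cusp_ring (F := F) in
    [/\ unibranch A,
        forall M : set (Omega F c), standard A M -> diamond A M = setT,
        [/\ standard A (setT : set (Omega F c)),
            (rkq A (setT : set (Omega F c)) - c)%N = c
          & std_flag nu A `&` [set p | smul (maxideal A) setT `<=` fbot p
                                       /\ ftop p `<=` setT]
            = std_flag nu A]
      & tofrac (Hmot nu A)
        = \sum_(0 <= d < c.+1)
            q%:R ^+ (c * d) * t_frac ^+ d * gauss_binom q c d * qfactor q d]).
Proof.
move=> q; split=> [A hA|A].
  have [L [uL hL]] := enum_standard c_gt0 hA.
  have fiber := contribution_fiber c_gt0 nu_first nu_incr nu_lt1 hA.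
  have [fS hmot] := Hmot_sum c_gt0 nu_first nu_incr nu_lt1 hA.
  split.
  - split=> //; have -> : [set M : set (Omega F c) | standard A M] = [set` L].
      by apply/seteqP; split=> M /hL.
    exact: finite_seq.
  - move=> M stM; split.
    + exact (codim_deg c_gt0 hA stM).
    + exact (codim_rkq c_gt0 hA stM).
    + exact (codim_diamond c_gt0 hA stM).
    exact (rkq_ge c_gt0 hA stM).
  - move=> M stM; split; [|exact: diamond_full|exact: diamond_eq].
    by apply: diamond_submodule => //; case: stM.
  - split=> // M M' stM stM' dd ddd; apply/eqP; rewrite -tofrac_eq.
    by rewrite !fiber // dd ddd.
  move=> N stN r S term; split.
  - exact: (contribution_between c_gt0 nu_first nu_incr nu_lt1 hA stN).
  - move=> d _.
    exact: (contribution_between_codim c_gt0 nu_first nu_incr nu_lt1 hA stN).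
  move=> p d Sp cd.
  have [_ _ [st _ bN]] := between_codim c_gt0 nu_first nu_incr nu_lt1 hA stN Sp.
  exact: (deg_between c_gt0 hA stN st bN cd).
have hA : unibranch A := cusp_unibranch.
have stT := @standard_setT F c A hA.
have SE : std_flag nu A `&` [set p | smul (maxideal A) setT `<=` fbot p
    /\ ftop p `<=` setT] = std_flag nu A.
  apply/seteqP; split=> [p []//|p h]; split=> //; split=> //.
  rewrite (cusp_smul c_gt0); apply: cusp_standard_low.
  by have [] := std_flag_sub_top c_gt0 nu_first nu_incr nu_lt1 hA h.
have rE : (rkq A (setT : set (Omega F c)) - c)%N = c.
  rewrite /rkq (@qdimE _ _ _ _ (2 * c)).
  - by rewrite mul2n -addnn addnK.
  - exact: smul_maxideal_subspace.
  - exact: subspaceT.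
  by rewrite (cusp_smul c_gt0); apply: codim_low.
split=> //; first by move=> M; apply: (cusp_diamond c_gt0).
have := contribution_between c_gt0 nu_first nu_incr nu_lt1 hA stT.
rewrite SE rE /Hmot => ->; apply: eq_bigr => d _.
have -> : deg (setT : set (Omega F c)) = 0%N.
  by apply: (@qdimE F c setT setT 0 subspaceT subspaceT); apply: codim_refl.
by rewrite add0n [t_frac ^+ d * _]mulrC.
Qed.
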